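(* Let $A$ be an algebra with an idempotent grading and a graded pre-Borelic subalgebra $B$ such that $H=B_0$ is standardly based. Then $(A,\mathcal Q)$ is base stratified, where $\mathcal Q$ is the decomposition $\Lambda=\bigsqcup_{i=0}^n\Lambda_i$ with $\Lambda_i=\{\lambda\in\Lambda:F_A(\lambda)=i\}$.
   Context: All algebras are finite-dimensional, associative and unital over a field $\Bbbk$; modules are finitely generated left modules; $\Lambda$ indexes simple $A$-modules $L(\lambda)$ with primitive idempotents $e_\lambda$; idempotents $e,f$ are equivalent if $Ae\cong Af$. Idempotent grading: mutually orthogonal (possibly zero) idempotents $1_A=e^\ast_0+\cdots+e^\ast_n$, $A_j=\bigoplus_ie^\ast_iAe^\ast_{i+j}$, $A_-=\bigoplus_{j<0}A_j$. A graded pre-Borelic subalgebra is a graded subalgebra $B$ with $B_j=0$ for $j<0$, $A=B\oplus A_-B$, $A$ projective as right $B$-module and $B$ projective as left $B_0$-module. $F_A(\lambda)$ is the least $i$ such that there is an idempotent in $e^\ast_iAe^\ast_i$ equivalent to $e_\lambda$. Standardly based structure: poset $(L,\le)$ and two-sided ideals $A^{\ge p}$ with $A^{\ge p}\supseteq A^{\ge q}$ for $p<q$; with $A^{>p}$ the sum of $A^{\ge q}$, $q>p$, there are complements $A^{(p)}$ of $A^{>p}$ in $A^{\ge p}$ with $\bigoplus_pA^{(p)}=A$ and $A^{\ge p}/A^{>p}\cong W(p)\otimes_\Bbbk W'(p)$ as bimodules. For an $n$-decomposition $\Lambda=\bigsqcup_{i=0}^n\Lambda_i$, let $J_0=0$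 and $J_i$ ($1\le i\le n+1$) be the two-sided ideal generated by the $e_\lambda$ with $\lambda\in\Lambda_0\cup\cdots\cup\Lambda_{i-1}$. An idempotent ideal $J=AeA$ is base stratifying if it is projective as left and as right $A$-module and $eAe$ is standardly based. $(A,\mathcal Q)$ is base stratified if $J_i/J_{i-1}$ is a base stratifying ideal of $A/J_{i-1}$ for each $1\le i\le n+1$.
   Formalization: The poset L of a standardly based structure is taken to be finite, in the hypothesis and in the conclusion; for arbitrary infinite posets, where an ideal need not be the sum of the complements above it, the claim as literally stated can fail. *)

(* Defs.v *)
From HB Require Import structures.
From mathcomp Require Import all_boot all_order all_algebra.
From mathcomp Require Import falgebra.
Set Implicit Arguments. Unset Strict Implicit. Unset Printing Implicit Defensive.
Import GRing.Theory.
Local Open Scope ring_scope.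

Section Defs.
Variable K : fieldType.

Section InAlg.
Variable A : falgType K.

Definition idempotent (e : A) : Prop := e * e = e.

Definition ideal (J : {vspace A}) : Prop :=
  (fullv * J <= J)%VS /\ (J * fullv <= J)%VS.

Definition gen_ideal (S : A -> Prop) (J : {vspace A}) : Prop :=
  [/\ ideal J, (forall a, S a -> a \in J) &
      forall I : {vspace A}, ideal I -> (forall a, S a -> a \in I) -> (J <= I)%VS].

Definition lideal_of (e : A) : {vspace A} := (fullv * <[e]>)%VS.
Definition corner (e : A) : {vspace A} := (<[e]> * fullv * <[e]>)%VS.

Definition idem_equiv (e f : A) : Prop :=
  exists phi : 'End(A),
    [/\ (phi @: lideal_of e = lideal_of f)%VS,
        (lker phi :&: lideal_of e = 0)%VS &
        forall a x, x \in lideal_of e -> phi (a * x) = a * phi x].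

Definition primitive_idem (e : A) : Prop :=
  [/\ e != 0, idempotent e &
      forall f g : A, idempotent f -> idempotent g -> f * g = 0 -> g * f = 0 ->
        e = f + g -> f = 0 \/ g = 0].

(* The finite set Lam indexes the simple A-modules L(lam) via primitive
   idempotents e_lam (L(lam) = top of A e_lam): every primitive idempotent
   is equivalent to exactly one e_lam. *)
Definition simple_index (Lam : finType) (eL : Lam -> A) : Prop :=
  [/\ forall l, primitive_idem (eL l),
      forall l l', idem_equiv (eL l) (eL l') -> l = l' &
      forall e, primitive_idem e -> exists l, idem_equiv e (eL l)].

(* M (a subspace) is a left R-module (R a subalgebra) which is projective:
   a direct summand of a free module R^k, i.e. there are R-linear maps
   p : R^k -> M and s : M -> R^k with p \o s = id_M. *)
Definition projective_left (R M : {vspace A}) : Prop :=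
  (R * M <= M)%VS /\
  exists (k : nat) (p : 'Hom({ffun 'I_k -> A}, A)) (s : 'Hom(A, {ffun 'I_k -> A})),
  [/\ forall x : {ffun 'I_k -> A}, (forall i, x i \in R) -> p x \in M,
      forall m, m \in M -> forall i, s m i \in R,
      forall r (x : {ffun 'I_k -> A}), r \in R -> (forall i, x i \in R) ->
        p [ffun i => r * x i] = r * p x,
      forall r m, r \in R -> m \in M -> s (r * m) = [ffun i => r * s m i] &
      forall m, m \in M -> p (s m) = m].

Definition projective_right (R M : {vspace A}) : Prop :=
  (M * R <= M)%VS /\
  exists (k : nat) (p : 'Hom({ffun 'I_k -> A}, A)) (s : 'Hom(A, {ffun 'I_k -> A})),
  [/\ forall x : {ffun 'I_k -> A}, (forall i, x i \in R) -> p x \in M,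
      forall m, m \in M -> forall i, s m i \in R,
      forall r (x : {ffun 'I_k -> A}), r \in R -> (forall i, x i \in R) ->
        p [ffun i => x i * r] = p x * r,
      forall r m, r \in R -> m \in M -> s (m * r) = [ffun i => s m i * r] &
      forall m, m \in M -> p (s m) = m].

(* Standardly based structure on the algebra S (a subspace of A closed under
   multiplication, with identity element u).  Ideals A^{>=p} of S indexed by a
   finite poset (L, le); A^{>p} = sum of A^{>=q}, q > p; complements A^{(p)};
   A^{>=p}/A^{>p} is isomorphic as an S-bimodule to W(p) (x) W'(p), where the
   left S-module W(p) is realised on K^m via rho : S -> 'M_m, the right
   S-module W'(p) on K^m' via sig : S -> 'M_m', so that W(p) (x) W'(p) is
   'M_(m,m') with a.X = rho a *m X and X.a = X *m sig a.  The bimodule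
   isomorphism from the quotient is given by a surjective map psi on A^{>=p}
   with kernel A^{>p}. *)
Definition std_based (S : {vspace A}) (u : A) : Prop :=
  exists (L : finType) (le : rel L) (Ageq Ap : L -> {vspace A}),
  let lt p q := le p q && (p != q) in
  let Agt p := (\sum_(q | lt p q) Ageq q)%VS in
  [/\ [/\ reflexive le, antisymmetric le & transitive le],
      forall p, [/\ (Ageq p <= S)%VS, (S * Ageq p <= Ageq p)%VS &
                    (Ageq p * S <= Ageq p)%VS],
      (forall p q, lt p q -> (Ageq q <= Ageq p)%VS) /\
      (forall p, (Ap p + Agt p = Ageq p)%VS /\ (Ap p :&: Agt p = 0)%VS),
      (\sum_p Ap p = S)%VS /\ \dim (\sum_p Ap p)%VS = (\sum_p \dim (Ap p))%N &
      forall p, exists (m m' : nat) (rho : 'Hom(A, 'M[K]_m))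
                  (sig : 'Hom(A, 'M[K]_m')) (psi : 'Hom(A, 'M[K]_(m, m'))),
        [/\ (forall a b, a \in S -> b \in S -> rho (a * b) = rho a *m rho b)
              /\ rho u = 1%:M,
            (forall a b, a \in S -> b \in S -> sig (a * b) = sig a *m sig b)
              /\ sig u = 1%:M,
            (psi @: Ageq p = fullv)%VS,
            (lker psi :&: Ageq p = Agt p)%VS &
            forall a x, a \in S -> x \in Ageq p ->
              psi (a * x) = rho a *m psi x /\ psi (x * a) = psi x *m sig a]].

Definition base_stratifying (J : {vspace A}) : Prop :=
  exists e : A,
  [/\ idempotent e, J = (fullv * <[e]> * fullv)%VS,
      projective_left fullv J, projective_right fullv J &
      std_based (corner e) e].

Variable n : nat.
Variable estar : 'I_n.+1 -> A.

Definition idem_grading : Prop :=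
  [/\ forall i, idempotent (estar i),
      forall i k, i != k -> estar i * estar k = 0 &
      \sum_i estar i = 1].

Definition Agr (j : int) : {vspace A} :=
  (\sum_(i < n.+1) \sum_(k < n.+1 | (k%:Z == i%:Z + j)%R)
     (<[estar i]> * fullv * <[estar k]>))%VS.

(* A_- = sum of A_j, j < 0  (A_j = 0 for j < -n) *)
Definition Aminus : {vspace A} :=
  (\sum_(1 <= d < n.+1) Agr (- (d%:Z)))%VS.

Definition pre_borelic (B : {aspace A}) : Prop :=
  [/\ 1 \in (B : {vspace A}),
      ((B : {vspace A}) <= \sum_(d < (n + n).+1) (B :&: Agr (d%:Z - n%:Z)))%VS
        /\ (forall j : int, (j < 0)%R -> (B :&: Agr j = 0)%VS),
      ((B : {vspace A}) + Aminus * B = fullv)%VS /\ (B :&: (Aminus * B) = 0)%VS,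
      projective_right B fullv &
      projective_left (B :&: Agr 0)%VS B].

Definition Fle (e : A) (i : 'I_n.+1) : Prop :=
  exists f, [/\ f \in corner (estar i), idempotent f & idem_equiv f e].

Definition FA_is (e : A) (i : 'I_n.+1) : Prop :=
  Fle e i /\ forall j : 'I_n.+1, (j < i)%N -> ~ Fle e j.

Definition Jgens (Lam : finType) (eL : Lam -> A) (i : nat) : A -> Prop :=
  fun a => exists l, a = eL l /\ exists j : 'I_n.+1, (j < i)%N /\ FA_is (eL l) j.

End InAlg.
End Defs.

(* Main.v *)
(** The ideal [J r] generated by the [e_lam] with [F_A(lam) < r] is the sum of
    the [A e*_i A] for [i < r].  Since [B] need not contain the [e*_i], they are
    replaced inside [H] by [h_i], the image of [e*_i] under the projection of
    [A] onto [B] along [A_- B]: the [h_i] are orthogonal central idempotents of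
    [H], and for [b] in [B] one has [e*_r b \in J r] iff [h_r b = 0].  Hence,
    modulo [J r], [e*_r A] is [h_r B], which is projective over
    [e*_r A e*_r = h_r H], and the latter is a direct factor of [H], hence
    standardly based.

    By induction [A / J r] is a projective right [B]-module; its dual basis
    induces one of [A e*_r / J r] over [e*_r H].  As [B] is graded in degrees
    [0..n], a Nakayama argument on the degree shows that the multiplication
    [A e*_r (x) e*_r A -> J (r+1) / J r], with tensor product over
    [e*_r A e*_r], is bijective.  This makes [J (r+1) / J r] projective on both
    sides and a direct summand of [A / J r] over [B], so that [A / J (r+1)] is
    again projective over [B]. *)

Require Import Defs.
From HB Require Import structures.
From mathcomp Require Import all_boot all_order all_algebra.
From mathcomp Require Import falgebra.
From mathcomp Require Import zify.
From Stdlib Require Import Classical_Prop.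
Import GRing.Theory.
(* [ssrfun] also has an [idempotent]; the one meant here is that of Defs. *)
Import Defs.
Local Open Scope ring_scope.
Set Implicit Arguments. Unset Strict Implicit. Unset Printing Implicit Defensive.

(** * Linear maps, corners and ideals *)

Section LinearMaps.
Variables (K : fieldType) (U V : vectType K).

Lemma linear_homE (g : U -> V) : linear g -> exists h : 'Hom(U, V), h =1 g.
Proof.
move=> lin_g; pose g' : {linear U -> V} := HB.pack g (GRing.isLinear.Build _ _ _ _ _ lin_g).
by exists (linfun g') => x; rewrite lfunE.
Qed.

Lemma sub_lkerP (W : {vspace U}) (h : 'Hom(U, V)) :
  reflect (forall x, x \in W -> h x = 0) (W <= lker h)%VS.
Proof.
apply: (iffP subvP) => [WK x /WK|WK x /WK]; rewrite memv_ker; first by move/eqP.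
by move->; rewrite eqxx.
Qed.

End LinearMaps.

Section Corners.
Variables (K : fieldType) (A : falgType K).
Implicit Types (e f x y z : A) (U W J : {vspace A}).

Lemma amullE x y : amull x y = x * y. Proof. by rewrite lfunE. Qed.
Lemma amulrE x y : amulr x y = y * x. Proof. by rewrite lfunE. Qed.

Lemma mem_prod_line U e x :
  reflect (exists2 y, y \in U & x = y * e) (x \in (U * <[e]>)%VS).
Proof.
rewrite -limg_amulr; apply: (iffP memv_imgP) => -[y yU ->]; exists y => //.
  by rewrite amulrE.
by rewrite amulrE.
Qed.

Lemma mem_lideal e x : reflect (exists y, x = y * e) (x \in lideal_of e).
Proof.
apply: (iffP (mem_prod_line _ _ _)) => [[y _ ->]|[y ->]]; first by exists y.
by exists y; rewrite ?memvf.
Qed.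

Lemma mem_lideal_idem e x : idempotent e -> reflect (x = x * e) (x \in lideal_of e).
Proof.
move=> ee; apply: (iffP (mem_lideal _ _)) => [[y ->]|->]; last by exists x.
by rewrite -mulrA ee.
Qed.

Lemma line_mul_sub e U W :
  (forall u, u \in U -> e * u \in W) -> (<[e]> * U <= W)%VS.
Proof.
move=> UW; apply/prodvP => _ u /vlineP[k ->] uU.
by rewrite -scalerAl memvZ // UW.
Qed.

Lemma mem_mul_corner e f x : e * x * f \in (<[e]> * fullv * <[f]>)%VS.
Proof. by rewrite !memv_mul ?memv_line ?memvf. Qed.

Lemma mul_corner_sub e f W :
  (forall x, e * x * f \in W) -> (<[e]> * fullv * <[f]> <= W)%VS.
Proof.
move=> eW; rewrite -prodvA; apply: line_mul_sub => u.
by case/mem_prod_line => y _ ->; rewrite mulrA.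
Qed.

Lemma mem_cornerP e x : idempotent e ->
  reflect (e * x = x /\ x * e = x) (x \in corner e).
Proof.
move=> ee; apply: (iffP idP) => [|[ex xe]]; last first.
  by rewrite -xe -ex; apply: mem_mul_corner.
have Le : (corner e <= lker (amull e - \1%VF) :&: lker (amulr e - \1%VF))%VS.
  apply: mul_corner_sub => y.
  rewrite memv_cap !memv_ker !(add_lfunE, opp_lfunE, id_lfunE, amullE, amulrE).
  by rewrite !mulrA ee -!mulrA ee !subrr eqxx.
move/(subvP Le); rewrite memv_cap !memv_ker !(add_lfunE, opp_lfunE, id_lfunE).
by rewrite amullE amulrE !subr_eq0 => /andP[/eqP ? /eqP ?].
Qed.

Definition gen_by e : {vspace A} := (fullv * <[e]> * fullv)%VS.

Lemma mem_gen_by e x y : x * e * y \in gen_by e.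
Proof. by rewrite !memv_mul ?memv_line ?memvf. Qed.

Lemma gen_by_sub e W : (forall x y, x * e * y \in W) -> (gen_by e <= W)%VS.
Proof. by move=> eW; apply/prodvP => _ y /mem_lideal[x ->] _. Qed.

Lemma ideal_mull J x y : ideal J -> y \in J -> x * y \in J.
Proof. by case=> Jl _ yJ; apply: (subvP Jl); rewrite memv_mul ?memvf. Qed.

Lemma ideal_mulr J x y : ideal J -> x \in J -> x * y \in J.
Proof. by case=> _ Jr xJ; apply: (subvP Jr); rewrite memv_mul ?memvf. Qed.

Lemma ideal_gen_by e : ideal (gen_by e).
Proof.
split; rewrite /gen_by; first by rewrite !prodvA !prodvSl ?subvf.
by rewrite -prodvA prodvSr ?subvf.
Qed.

Lemma ideal_sumv (I : finType) (P : pred I) (F : I -> {vspace A}) :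
  (forall i, P i -> ideal (F i)) -> ideal (\sum_(i | P i) F i)%VS.
Proof.
move=> idF; apply: (big_ind (fun J : {vspace A} => ideal J)) => //.
  by split; rewrite ?prodv0 ?prod0v subvv.
by move=> U W [Ul Ur] [Wl Wr]; split; rewrite ?prodvDr ?prodvDl addvS.
Qed.

End Corners.

(** * Idempotent gradings *)

Section Grading.
Variables (K : fieldType) (A : falgType K) (n : nat) (e : 'I_n.+1 -> A).
Hypothesis eG : idem_grading e.
Implicit Types (x y z b : A) (i j k : 'I_n.+1).

Lemma estar_idem i : e i * e i = e i. Proof. by case: eG => H _ _; apply: H. Qed.

Lemma estar_orth i k : i != k -> e i * e k = 0. Proof. by case: eG => _ H _; apply: H. Qed.

Lemma estar_sum : \sum_i e i = 1. Proof. by case: eG. Qed.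

Lemma estarM i k : e i * e k = (i == k)%:R *: e i.
Proof. by case: eqP => [<-|/eqP/estar_orth->]; rewrite ?estar_idem ?scale1r ?scale0r. Qed.

Lemma peirce x : x = \sum_i \sum_k e i * x * e k.
Proof.
rewrite -[LHS]mul1r -[LHS]mulr1 -estar_sum mulr_suml mulr_suml.
by apply: eq_bigr => i _; rewrite mulr_sumr.
Qed.

Lemma peirce_ext x y : (forall i k, e i * x * e k = e i * y * e k) -> x = y.
Proof.
move=> xy; rewrite [x]peirce [y]peirce.
by apply: eq_bigr => i _; apply: eq_bigr.
Qed.

Lemma peirce_mul i k x y :
  e i * (x * y) * e k = \sum_j (e i * x * e j) * (e j * y * e k).
Proof.
rewrite -[in LHS](mulr1 x) -estar_sum mulr_sumr mulr_suml mulr_sumr mulr_suml.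
by apply: eq_bigr => j _; rewrite -[in LHS](estar_idem j) !mulrA.
Qed.

Lemma AgrP (d : int) x :
  reflect (forall i k, k%:Z != i%:Z + d -> e i * x * e k = 0) (x \in Agr e d).
Proof.
apply: (iffP idP) => [xA i k ikd|xA].
  have: (Agr e d <= lker (amulr (e k) \o amull (e i))%VF)%VS.
    apply/subv_sumP => i' _; apply/subv_sumP => k' kd'.
    apply: mul_corner_sub => y; rewrite memv_ker comp_lfunE amullE amulrE.
    rewrite !mulrA estarM -!scalerAl -mulrA estarM -scalerAr.
    case: (i =P i') => [ii|_]; last by rewrite scale0r.
    case: (k' =P k) => [kk|_]; last by rewrite scale0r scaler0.
    by move: ikd; rewrite ii -kk kd'.
  by move/subvP/(_ x xA); rewrite memv_ker comp_lfunE amullE amulrE => /eqP.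
rewrite [x]peirce; apply: rpred_sum => i _; apply: rpred_sum => k _.
have [kd|/xA->] := eqVneq k%:Z (i%:Z + d); last exact: rpred0.
apply: (subvP (sumv_sup i _ (sumv_sup k _ (subvv _)))) => //.
  by rewrite kd eqxx.
exact: mem_mul_corner.
Qed.

Lemma Agr0P x : reflect (forall i, e i * x = x * e i) (x \in Agr e 0).
Proof.
apply: (iffP (AgrP _ _)) => xA => [i|i k].
  have off j k : j != k -> e j * x * e k = 0.
    by move=> jk; apply: xA; apply: contra jk => /eqP; rewrite addr0 => -[] /val_inj ->.
  apply: peirce_ext => j k.
  have -> : e j * (e i * x) * e k = e j * e i * x * e k by rewrite !mulrA.
  have -> : e j * (x * e i) * e k = e j * x * (e i * e k) by rewrite !mulrA.
  rewrite !estarM -!scalerAl -!scalerAr.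
  case: (eqVneq j i) => [->|ji]; case: (eqVneq i k) => [<-|ik] //=.
  - by rewrite off // !(scaler0, scale0r).
  - by rewrite off // !(scaler0, scale0r).
  by rewrite !scale0r.
move=> ki; rewrite xA -mulrA estarM; case: eqP => [ik|_]; last by rewrite scale0r mulr0.
by rewrite ik addr0 eqxx in ki.
Qed.

Lemma AminusE : Aminus e = (\sum_(d < n.+1 | (0 < d)%N) Agr e (- (d%:Z)))%VS.
Proof. by rewrite /Aminus (big_nat_widenl _ 0) // big_mkord. Qed.

Lemma AminusP x :
  reflect (forall i k, (i <= k)%N -> e i * x * e k = 0) (x \in Aminus e).
Proof.
apply: (iffP idP) => [xA i k ik|xA].
  have: (Aminus e <= lker (amulr (e k) \o amull (e i))%VF)%VS.
    rewrite AminusE; apply/subv_sumP => d d0.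
    apply/subvP => y /AgrP yd; rewrite memv_ker comp_lfunE amullE amulrE yd //.
    by apply/eqP; lia.
  by move/subvP/(_ x xA); rewrite memv_ker comp_lfunE amullE amulrE => /eqP.
rewrite [x]peirce; apply: rpred_sum => i _; apply: rpred_sum => k _.
have [/xA->|ki] := leqP i k; first exact: rpred0.
rewrite AminusE.
have dn : (i - k < n.+1)%N by have := ltn_ord i; lia.
apply: (subvP (sumv_sup (Ordinal dn) _ (subvv _))) => /=; first by lia.
apply/AgrP => i' k' kd; rewrite !mulrA estarM -!scalerAl -mulrA estarM -scalerAr.
case: (i' =P i) => [ii|_]; last by rewrite scale0r.
case: (k =P k') => [kk|_]; last by rewrite scale0r scaler0.
by case/eqP: kd; rewrite ii -kk; lia.
Qed.

(** The projection of [A] onto the component of degree [d]; only nonnegative degrees are encoded, as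
    these are the degrees of [B]. *)
Definition part (d : nat) : 'End(A) :=
  \sum_(i < n.+1) \sum_(k : 'I_n.+1 | k == (i + d)%N :> nat) (amulr (e k) \o amull (e i))%VF.

Lemma partE d x :
  part d x = \sum_(i < n.+1) \sum_(k : 'I_n.+1 | k == (i + d)%N :> nat) e i * x * e k.
Proof.
rewrite sum_lfunE; apply: eq_bigr => i _; rewrite sum_lfunE.
by apply: eq_bigr => k _; rewrite comp_lfunE amulrE amullE.
Qed.

Lemma e_part_e d x i k :
  e i * part d x * e k = if k == (i + d)%N :> nat then e i * x * e k else 0.
Proof.
rewrite partE mulr_sumr mulr_suml (bigD1 i) //= [X in _ + X]big1 ?addr0 => [|j ji]; last first.
  rewrite mulr_sumr mulr_suml big1 // => l _.
  by rewrite !mulrA estar_orth ?mul0r // eq_sym.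
rewrite mulr_sumr mulr_suml big_mkcond (bigD1 k) //= [X in _ + X]big1 ?addr0 => [|j ji].
  by case: ifP => // _; rewrite !mulrA estar_idem -mulrA estar_idem.
by case: ifP => // _; rewrite -!mulrA estar_orth // !mulr0.
Qed.

Lemma part_id d x : x \in Agr e d%:Z -> part d x = x.
Proof.
move/AgrP=> xA; apply: peirce_ext => i k; rewrite e_part_e.
by case: eqP => // kd; rewrite xA //; apply/eqP; lia.
Qed.

Lemma part_eq0 d (d' : int) x : x \in Agr e d' -> d%:Z != d' -> part d x = 0.
Proof.
move/AgrP=> xA dd; apply: peirce_ext => i k; rewrite e_part_e mulr0 mul0r.
by case: eqP => // kd; rewrite xA //; apply/eqP; lia.
Qed.

Lemma part_Agr d x : part d x \in Agr e d%:Z.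
Proof. by apply/AgrP => i k kd; rewrite e_part_e; case: eqP => //; lia. Qed.

Lemma e_part0 i x : e i * part 0 x = e i * x * e i.
Proof.
rewrite partE mulr_sumr (bigD1 i) //= [X in _ + X]big1 ?addr0 => [|j ji]; last first.
  by rewrite mulr_sumr big1 // => l _; rewrite !mulrA estar_orth ?mul0r // eq_sym.
rewrite (bigD1 i) ?addn0 //= [X in _ + X]big1 ?addr0 => [|k /andP[/eqP kk ki]]; last first.
  by case/eqP: ki; apply: val_inj.
by rewrite !mulrA estar_idem.
Qed.

Lemma part0_ext x y : (forall i, e i * x * e i = e i * y * e i) -> part 0 x = part 0 y.
Proof.
move=> xy; apply: peirce_ext => i k; rewrite !e_part_e addn0.
by case: eqP => // /val_inj->.
Qed.

End Grading.

(** * The projection onto B and the idempotents h_i *)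

Section PreBorelic.
Variables (K : fieldType) (A : falgType K) (n : nat) (e : 'I_n.+1 -> A).
Variable B : {aspace A}.
Hypotheses (eG : idem_grading e) (hB : pre_borelic e B).
Implicit Types (x y z b c m : A) (i j k r : 'I_n.+1).

Notation H := ((B : {vspace A}) :&: Agr e 0)%VS.
Notation AmB := (Aminus e * B)%VS.

Lemma one_in_B : 1 \in (B : {vspace A}). Proof. by case: hB. Qed.

Lemma B_components b : b \in (B : {vspace A}) ->
  exists2 v : 'I_(n + n).+1 -> A,
    forall d, v d \in (B :&: Agr e (d%:Z - n%:Z))%VS & b = \sum_d v d.
Proof.
case: hB => _ [/subvP Bsub _] _ _ _ /Bsub /memv_sumP[v vB ->].
by exists v => // d; apply: vB.
Qed.

Lemma part_in_B d b : b \in (B : {vspace A}) -> part e d b \in (B : {vspace A}).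
Proof.
case/B_components=> v vB ->; rewrite linear_sum /=; apply: rpred_sum => j _.
have:= vB j; rewrite memv_cap => /andP[vjB vjA].
have [dj|dj] := eqVneq d%:Z (j%:Z - n%:Z); last by rewrite (part_eq0 eG vjA) // mem0v.
by rewrite (part_id eG) // dj.
Qed.

Lemma B_nonneg b i k : b \in (B : {vspace A}) -> (k < i)%N -> e i * b * e k = 0.
Proof.
case/B_components=> v vB -> ki; rewrite mulr_sumr mulr_suml big1 // => j _.
(* Index [j] stands for degree [j - n]: for [j < n] the component is zero because [B] has no
   negative degrees, and otherwise it has no block below the diagonal. *)
have [jn|nj] := ltnP j n; last first.
  have:= vB j; rewrite memv_cap => /andP[_ /(AgrP eG)->] //.
  by apply/eqP; lia.
have: v j \in (B :&: Agr e (j%:Z - n%:Z))%VS by [].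
case: hB => _ [_ Bn] _ _ _; rewrite Bn ?memv0; last by lia.
by move/eqP->; rewrite mulr0 mul0r.
Qed.

Lemma part0_H b : b \in (B : {vspace A}) -> part e 0 b \in H.
Proof. by move=> bB; rewrite memv_cap part_in_B //= (part_Agr eG 0). Qed.

Lemma H_sub_B x : x \in H -> x \in (B : {vspace A}).
Proof. by rewrite memv_cap => /andP[]. Qed.

Lemma H_comm x i : x \in H -> e i * x = x * e i.
Proof. by rewrite memv_cap => /andP[_ /(Agr0P eG)]. Qed.

Lemma H_mul x y : x \in H -> y \in H -> x * y \in H.
Proof.
rewrite !memv_cap => /andP[xB /(Agr0P eG)xA] /andP[yB /(Agr0P eG)yA].
by rewrite memvM //=; apply/(Agr0P eG) => i; rewrite mulrA xA -mulrA yA mulrA.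
Qed.

Lemma one_in_H : 1 \in H.
Proof. by rewrite memv_cap one_in_B; apply/(Agr0P eG) => i; rewrite mul1r mulr1. Qed.

Lemma part0_id x : x \in H -> part e 0 x = x.
Proof. by rewrite memv_cap => /andP[_ xA]; rewrite (part_id eG). Qed.

(** Elements of [B] are block upper triangular, so the diagonal blocks of a product are the products
    of the diagonal blocks. *)
Lemma part0M b c : b \in (B : {vspace A}) -> c \in (B : {vspace A}) ->
  part e 0 (b * c) = part e 0 b * part e 0 c.
Proof.
move=> bB cB; have pp : part e 0 b * part e 0 c \in H by rewrite H_mul ?part0_H.
rewrite -[RHS]part0_id //; apply: (part0_ext eG) => i.
rewrite !(peirce_mul eG); apply: eq_bigr => j _; rewrite !(e_part_e eG) !addn0.
case: (eqVneq (j : nat) i) => [/val_inj->|ji]; first by [].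

rewrite mul0r; have [ij|/B_nonneg->] := leqP i j; rewrite ?mul0r //.
by rewrite [X in _ * X]B_nonneg ?mulr0 // ltn_neqAle eq_sym ji.
Qed.

(** The elements of [B] of degree at least [d]. This filtration reaches zero at [n.+1], which ends
    the Nakayama arguments below. *)
Definition Bge (d : nat) b :=
  b \in (B : {vspace A}) /\ forall i k, (k < i + d)%N -> e i * b * e k = 0.

Lemma Bge0 b : b \in (B : {vspace A}) -> Bge 0 b.
Proof. by split=> // i k; rewrite addn0; apply: B_nonneg. Qed.

Lemma Bge_eq0 b : Bge n.+1 b -> b = 0.
Proof.
case=> _ b0; apply: (peirce_ext eG) => i k; rewrite b0 ?mulr0 ?mul0r //.
by have := ltn_ord k; lia.
Qed.

Lemma Bge_mul d b c : Bge 1 b -> Bge d c -> Bge d.+1 (b * c).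
Proof.
case=> bB b0 [cB c0]; split=> [|i k ik]; first exact: memvM.
rewrite (peirce_mul eG) big1 // => j _.
have [ji|ij] := leqP j i; first by rewrite b0 ?mul0r // addn1 ltnS.
by rewrite c0 ?mulr0 //; lia.
Qed.

Lemma Bge_sum d (I : finType) (F : I -> A) : (forall t, Bge d (F t)) -> Bge d (\sum_t F t).
Proof.
move=> FB; split=> [|i k ik]; first by apply: rpred_sum => t _; case: (FB t).
by rewrite mulr_sumr mulr_suml big1 // => t _; case: (FB t) => _ ->.
Qed.

Lemma Bge_opp d b : Bge d b -> Bge d (- b).
Proof. by case=> bB b0; split=> [|i k ik]; rewrite ?rpredN // mulrN mulNr b0 ?oppr0. Qed.

Lemma Bge_sub_part0 b : b \in (B : {vspace A}) -> Bge 1 (b - part e 0 b).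
Proof.
move=> bB; split=> [|i k ki]; first by apply: rpredB; rewrite ?part_in_B.
rewrite mulrBr mulrBl (e_part_e eG) addn0; case: eqP => [|nki]; first by rewrite subrr.
by rewrite subr0 B_nonneg //; lia.
Qed.

Lemma Agr0_Aminus x m : x \in Agr e 0 -> m \in Aminus e -> x * m \in Aminus e.
Proof.
move=> /(Agr0P eG)xA /(AminusP eG)m0; apply/(AminusP eG) => i k ik.
by rewrite mulrA xA -!mulrA mulrA mulrA -(mulrA x) -mulrA m0 // mulr0.
Qed.

Lemma Aminus_Agr0 x m : x \in Agr e 0 -> m \in Aminus e -> m * x \in Aminus e.
Proof.
move=> /(Agr0P eG)xA /(AminusP eG)m0; apply/(AminusP eG) => i k ik.
by rewrite -mulrA -mulrA -xA !mulrA m0 // mul0r.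
Qed.

Lemma e_Agr0 i : e i \in Agr e 0.
Proof.
apply/(Agr0P eG) => k; rewrite !(estarM eG).
by case: eqVneq => [->|ki]; rewrite ?scale0r // eqxx.
Qed.

Lemma AmB_mulr c b : c \in AmB -> b \in (B : {vspace A}) -> c * b \in AmB.
Proof.
move=> cA bB; have: c * b \in (AmB * B)%VS by rewrite memv_mul.
by rewrite -prodvA prodv_id.
Qed.

Lemma AmB_mull x c : x \in Agr e 0 -> c \in AmB -> x * c \in AmB.
Proof.
move=> xA; rewrite -(amullE x) memv_preim; apply/subvP: c; apply/prodvP => m b mA bB.
by rewrite -memv_preim amullE mulrA memv_mul // Agr0_Aminus.
Qed.

Lemma e_part d b i k : (i + d)%N = k -> e i * part e d b = e i * b * e k.
Proof.
move=> ik; rewrite -[LHS]mulr1 -(estar_sum eG) mulr_sumr (bigD1 k) //= big1 ?addr0.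
  by rewrite (e_part_e eG) ik eqxx.
by move=> j jk; rewrite (e_part_e eG) ik; case: eqP => // /val_inj jk'; rewrite jk' eqxx in jk.
Qed.

(** A diagonal block of [m * b] is a sum of terms [e i * m * e k * b * e i] with [k < i]. Since
    [e k * b * e i] equals [e k * part e (i - k) b], each term is an element of [A_-] times an
    element of [B]. *)
Lemma part0_AmB c : c \in AmB -> part e 0 c \in AmB.
Proof.
rewrite memv_preim; apply/subvP: c; apply/prodvP => m b mA bB; rewrite -memv_preim.
have ->: part e 0 (m * b) = \sum_i \sum_k e i * m * e k * b * e i.
  rewrite -[LHS]mul1r -(estar_sum eG) mulr_suml; apply: eq_bigr => i _.
  rewrite (e_part0 eG) -{1}[m]mulr1 -(estar_sum eG) !(mulr_sumr, mulr_suml).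
  by apply: eq_bigr => k _; rewrite !mulrA.
apply: rpred_sum => i _; apply: rpred_sum => k _.
have [ik|ki] := leqP i k; first by rewrite (AminusP eG _ mA) // !mul0r mem0v.
rewrite -!mulrA (mulrA (e k)) -(@e_part (i - k)%N) ?subnKC 1?ltnW // !mulrA.
rewrite memv_mul ?part_in_B //; rewrite -mulrA Agr0_Aminus ?e_Agr0 //.
by rewrite Aminus_Agr0 ?e_Agr0.
Qed.

Definition projB : 'End(A) := daddv_pi B AmB.

Lemma projB_in x : projB x \in (B : {vspace A}). Proof. exact: memv_pi. Qed.

Lemma B_AmB_dir : ((B : {vspace A}) :&: AmB = 0)%VS.
Proof. by case: hB => _ _ [_]. Qed.

Lemma sub_projB x : x - projB x \in AmB.
Proof.
case: hB => _ _ [BA dBA] _ _.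
have xBA : x \in (B + AmB)%VS by rewrite BA memvf.
by rewrite -{1}(daddv_pi_add dBA xBA) addrC addKr memv_pi.
Qed.

Lemma projB_uniq x b : b \in (B : {vspace A}) -> x - b \in AmB -> projB x = b.
Proof.
move=> bB xb; apply/eqP; rewrite -subr_eq0 -memv0 -B_AmB_dir memv_cap.
apply/andP; split; first by apply: rpredB; rewrite ?projB_in.
have ->: projB x - b = (x - b) - (x - projB x) by rewrite opprB [RHS]addrC addrA subrK.
exact: rpredB xb (sub_projB x).
Qed.

Lemma projB_AmB c : c \in AmB -> projB c = 0.
Proof. by move=> cA; apply: projB_uniq; rewrite ?subr0 ?mem0v. Qed.

Lemma projB_mulr x b : b \in (B : {vspace A}) -> projB (x * b) = projB x * b.
Proof.
by move=> bB; apply: projB_uniq; rewrite ?memvM ?projB_in // -mulrBl AmB_mulr ?sub_projB.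
Qed.

Lemma projB_mull x y : x \in H -> projB (x * y) = x * projB y.
Proof.
rewrite memv_cap => /andP[xB xA].
by apply: projB_uniq; rewrite ?memvM ?projB_in // -mulrBr AmB_mull ?sub_projB.
Qed.

Definition h i := projB (e i).

(** Both [B] and [A_- B] are stable under [part e 0], so the components of the degree 0 element
    [e i] along them again have degree 0. *)
Lemma h_H i : h i \in H.
Proof.
have hi : h i = part e 0 (h i); last by rewrite hi part0_H ?projB_in.
apply: projB_uniq; first by rewrite part_in_B ?projB_in.
by rewrite -{1}(part_id eG (e_Agr0 i)) -linearB /= part0_AmB ?sub_projB.
Qed.

Lemma e_sub_h i : e i - h i \in AmB. Proof. exact: sub_projB. Qed.

Lemma h_comm i x : x \in H -> h i * x = x * h i.
Proof.
by move=> xH; rewrite -projB_mulr ?H_sub_B // (H_comm i xH) projB_mull.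
Qed.

Lemma e_h_AmB i k : i != k -> e i * h k \in AmB.
Proof.
move=> ik; rewrite -[h k](subKr (e k)) mulrBr (estar_orth eG ik) sub0r rpredN.
by rewrite AmB_mull ?e_Agr0 ?sub_projB.
Qed.

Lemma hM i k : h i * h k = (i == k)%:R *: h i.
Proof.
rewrite -projB_mulr ?H_sub_B ?h_H //.
have [<-|ik] := eqVneq i k; last by rewrite scale0r projB_AmB ?e_h_AmB.
rewrite scale1r; apply: projB_uniq; first exact: projB_in.
rewrite (_ : e i * h i - h i = (e i - h i) - (e i * (e i - h i))).
  by apply: rpredB; rewrite ?AmB_mull ?e_Agr0 ?sub_projB.
by rewrite mulrBr (estar_idem eG) opprB [RHS]addrC addrA subrK.
Qed.

Lemma h_idem i : h i * h i = h i. Proof. by rewrite hM eqxx scale1r. Qed.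

Definition J (r : nat) : {vspace A} := (\sum_(i < n.+1 | (i < r)%N) gen_by (e i))%VS.

Lemma J_ideal (r : nat) : ideal (J r).
Proof. by apply: ideal_sumv => i _; apply: ideal_gen_by. Qed.

Lemma mem_J (r : nat) i x y : (i < r)%N -> x * e i * y \in J r.
Proof. by move=> ir; apply: (subvP (sumv_sup i ir (subvv _))); apply: mem_gen_by. Qed.

Lemma J_sub (r : nat) (W : {vspace A}) :
  (forall i x y, (i < r)%N -> x * e i * y \in W) -> (J r <= W)%VS.
Proof. by move=> eW; apply/subv_sumP => i ir; apply: gen_by_sub => x y; apply: eW. Qed.

Lemma JS r : J r.+1 = (J r + gen_by (e r))%VS.
Proof.
rewrite /J (bigD1 r) //= addvC; congr (_ + _)%VS; apply: eq_bigl => i.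
by rewrite ltnS ltn_neqAle andbC.
Qed.

Lemma J_S_sub r : (J r <= J r.+1)%VS. Proof. by rewrite JS addvSl. Qed.

Lemma mem_JS r x y : x * e r * y \in J r.+1. Proof. exact: mem_J. Qed.

(** Negative degree leaves only the blocks [e r * m * e k] with [k < r], which factor through
    generators of [J r]. *)
Lemma e_Aminus_J r m : m \in Aminus e -> e r * m \in J r.
Proof.
move=> mA; rewrite -[e r * m]mulr1 -(estar_sum eG) mulr_sumr.
apply: rpred_sum => k _; have [rk|kr] := leqP r k.
  by rewrite (AminusP eG _ mA) // mem0v.
by rewrite -[_ * e k]mulr1 mem_J.
Qed.

Lemma e_AmB_J r c : c \in AmB -> e r * c \in J r.
Proof.
rewrite -(amullE (e r)) memv_preim; apply/subvP: c; apply/prodvP => m b mA bB.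
by rewrite -memv_preim amullE mulrA (ideal_mulr _ (J_ideal r)) ?e_Aminus_J.
Qed.

(** This reduces every row [e r * A], modulo [J r], to a row of [B]. *)
Lemma e_projB_J r x : e r * x - e r * projB x \in J r.
Proof. by rewrite -mulrBr e_AmB_J ?sub_projB. Qed.

(* The part of positive degree of [b] lands in the rows of [e i] with [i < r]. *)
Lemma B_e_J r b : b \in (B : {vspace A}) -> b * e r - e r * part e 0 b \in J r.
Proof.
move=> bB; rewrite (e_part0 eG) -{1}[b]mul1r -(estar_sum eG) !mulr_suml (bigD1 r) //=.
rewrite addrAC subrr add0r; apply: rpred_sum => i ir.
have [ri|ri] := ltnP r i; first by rewrite B_nonneg ?mem0v.
by rewrite -mulrA -[e i]mul1r mem_J // ltn_neqAle ir.
Qed.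

Lemma e_H_h_J r b : b \in (B : {vspace A}) -> e r * b - e r * (h r * b) \in J r.
Proof.
move=> bB; rewrite mulrA -mulrBl -[X in X - _]mulr1.
rewrite -mulrBr (ideal_mulr _ (J_ideal r)) // mulrBr mulr1.
have := e_AmB_J r (e_sub_h r).
by rewrite mulrBr (estar_idem eG).
Qed.

(* [projB] maps [J r] into the sum of the [h i * B] with [i < r]. *)
Lemma h_projB_J (r : nat) k x : (r <= n.+1)%N -> x \in J r -> (r <= k)%N -> h k * projB x = 0.
Proof.
elim: r k x => [|r IH] k x rn xJ rk.
  by move: xJ; rewrite /J big1 // memv0 => /eqP->; rewrite linear0 mulr0.
pose r' := Ordinal (rn : (r < n.+1)%N).
have {}IH x' : x' \in J r -> h k * projB x' = 0 by move=> x'J; apply: IH => //; lia.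
suff: (J r.+1 <= lker (amull (h k) \o projB)%VF)%VS.
  by move/subvP/(_ x xJ); rewrite memv_ker comp_lfunE amullE => /eqP.
rewrite (JS r') subv_add; apply/andP; split.
  by apply/sub_lkerP => y yJ; rewrite comp_lfunE amullE IH.
apply: gen_by_sub => u y; rewrite memv_ker comp_lfunE amullE.
have IdJ := J_ideal r.
(* Modulo [J r], which the induction hypothesis disposes of, the column of [e r'] in an element of
   [B] is [e r'] times an element of [H]. *)
have step b : b \in (B : {vspace A}) -> exists2 c, c \in H & b * e r' - e r' * c \in J r.
  by move=> bB; exists (part e 0 b); rewrite ?part0_H // (B_e_J r').
have kr : k != r' by rewrite -val_eqE /= neq_ltn rk orbT.
(* The factor [y] is replaced by its projection to [B], which comes out of [projB] on the right;
   only [u * e r'] remains. *)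
rewrite (_ : u * e r' * y = u * (e r' * projB y) + u * (e r' * y - e r' * projB y)); last first.
  by rewrite mulrBr addrC subrK mulrA.
rewrite linearD /= mulrDr (IH (u * (_ - _))) ?addr0; last first.
  exact: (ideal_mull _ IdJ (e_projB_J r' y)).
rewrite mulrA projB_mulr ?projB_in // mulrA; set b := projB y.
suff -> : h k * projB (u * e r') = 0 by rewrite mul0r.
(* Split [u] along [B] and [A_- B]. The part in [B] yields [h k * h r'], which is 0 as [k != r'].
   The other part stays in [A_- B] modulo [J r], because [m * e r'] is again in [A_-], and [projB]
   kills it. *)
rewrite (_ : u * e r' = projB u * e r' + (u - projB u) * e r'); last first.
  by rewrite -mulrDl addrC subrK.
rewrite linearD /= mulrDr.
have -> : h k * projB (projB u * e r') = 0.
  have [c cH cJ] := step _ (projB_in u).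
  rewrite -[projB u * e r'](subrK (e r' * c)) linearD /= mulrDr IH // add0r.
  by rewrite projB_mulr ?H_sub_B // mulrA hM (negPf kr) scale0r mul0r.
rewrite add0r; have := sub_projB u; move: (u - projB u) => c cA; apply/eqP.
suff: (AmB <= lker (amull (h k) \o projB \o amulr (e r'))%VF)%VS.
  by move/subvP/(_ c cA); rewrite memv_ker !comp_lfunE amullE amulrE.
apply/prodvP => m b' mA b'B; rewrite memv_ker !comp_lfunE amullE amulrE.
have [c' c'H c'J] := step _ b'B.
rewrite -mulrA -[b' * e r'](subrK (e r' * c')) mulrDr linearD /= mulrDr.
rewrite IH ?(ideal_mull _ IdJ) // add0r mulrA.
by rewrite projB_AmB ?mulr0 // memv_mul ?H_sub_B // Aminus_Agr0 ?e_Agr0.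
Qed.

Lemma e_mem_J r b : b \in (B : {vspace A}) -> (e r * b \in J r) = (h r * b == 0).
Proof.
move=> bB; apply/idP/eqP => [erJ|hb].
  have:= h_projB_J (ltnW (ltn_ord r)) erJ (leqnn r).
  by rewrite projB_mulr // mulrA h_idem.
by have:= e_H_h_J r bB; rewrite hb mulr0 subr0.
Qed.

End PreBorelic.

(** * Dual bases and the Nakayama argument *)

Section DualBases.
Variables (K : fieldType) (A : falgType K).
Implicit Types R M : {vspace A}.

Lemma coordinate_maps k (s : 'Hom(A, {ffun 'I_k -> A})) :
  exists alpha : 'I_k -> 'End(A), forall t x, alpha t x = s x t.
Proof.
suff: forall t, exists alpha : 'End(A), forall x, alpha x = s x t.
  by case/fin_all_exists => alpha; exists alpha.
by move=> t; apply: linear_homE => c x y; rewrite linearP !ffunE.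
Qed.

(** The dual basis lemma: the generators are the images of the unit vectors of [R^k], the
    functionals are the coordinates of the splitting. *)
Lemma right_dual_basis R M : 1 \in R -> projective_right R M ->
  exists k (a : 'I_k -> A) (alpha : 'I_k -> 'End(A)),
  [/\ forall t, a t \in M,
      forall t x, x \in M -> alpha t x \in R,
      forall t x b, x \in M -> b \in R -> alpha t (x * b) = alpha t x * b &
      forall x, x \in M -> x = \sum_t a t * alpha t x].
Proof.
move=> R1 [_ [k [p [s [pM sR projB sB ps]]]]].
have [alpha alE] := coordinate_maps s.
pose d t : {ffun 'I_k -> A} := [ffun i => (i == t)%:R].
have dR t i : d t i \in R by rewrite ffunE; case: eqP; rewrite ?mem0v.
exists k, (fun t => p (d t)), alpha; split=> [t|t x xM|t x b xM bR|x xM].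
- exact: pM.
- by rewrite alE sR.
- by rewrite !alE sB // ffunE.
rewrite -{1}(ps x xM); have -> : s x = \sum_t [ffun i => d t i * alpha t x].
  apply/ffunP => i; rewrite sum_ffunE (bigD1 i) //= !ffunE eqxx mul1r alE.
  rewrite big1 ?addr0 // => t ti; rewrite !ffunE.
  by rewrite eq_sym (negPf ti) mul0r.
by rewrite linear_sum /=; apply: eq_bigr => t _; rewrite projB ?alE ?sR.
Qed.

Lemma left_dual_basis R M : 1 \in R -> projective_left R M ->
  exists k (a : 'I_k -> A) (alpha : 'I_k -> 'End(A)),
  [/\ forall t, a t \in M,
      forall t x, x \in M -> alpha t x \in R,
      forall t x b, x \in M -> b \in R -> alpha t (b * x) = b * alpha t x &
      forall x, x \in M -> x = \sum_t alpha t x * a t].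
Proof.
move=> R1 [_ [k [p [s [pM sR projB sB ps]]]]].
have [alpha alE] := coordinate_maps s.
pose d t : {ffun 'I_k -> A} := [ffun i => (i == t)%:R].
have dR t i : d t i \in R by rewrite ffunE; case: eqP; rewrite ?mem0v.
exists k, (fun t => p (d t)), alpha; split=> [t|t x xM|t x b xM bR|x xM].
- exact: pM.
- by rewrite alE sR.
- by rewrite !alE sB // ffunE.
rewrite -{1}(ps x xM); have -> : s x = \sum_t [ffun i => alpha t x * d t i].
  apply/ffunP => i; rewrite sum_ffunE (bigD1 i) //= !ffunE eqxx mulr1 alE.
  rewrite big1 ?addr0 // => t ti; rewrite !ffunE.
  by rewrite eq_sym (negPf ti) mulr0.
by rewrite linear_sum /=; apply: eq_bigr => t _; rewrite projB ?alE ?sR.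
Qed.

End DualBases.

(** * Right coordinates on [J r.+1] modulo [J r], and the passage from [A / J r] to [A / J r.+1] *)

Section Stage.
Variables (K : fieldType) (A : falgType K) (n : nat) (e : 'I_n.+1 -> A).
Variable B : {aspace A}.
Hypotheses (eG : idem_grading e) (hB : pre_borelic e B).
Implicit Types (x y z b c m : A).

Notation H := ((B : {vspace A}) :&: Agr e 0)%VS.
Notation J := (J e).
Notation projB := (projB e B).
Notation h := (h e B).

(** A dual basis of the right [B]-module [A / I], lifted to [A]: the functionals vanish on [I],
    while the expansion holds only modulo [I]. The induction on [r] thus stays inside [A]. *)
Definition dual_basis_mod (I : {vspace A}) k (a : 'I_k -> A) (alpha : 'I_k -> 'End(A)) :=
  [/\ forall t x, alpha t x \in (B : {vspace A}),
      forall t x b, b \in (B : {vspace A}) -> alpha t (x * b) = alpha t x * b,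
      forall t x, x \in I -> alpha t x = 0 &
      forall x, x - \sum_t a t * alpha t x \in I].

Definition Bge_space d : {vspace A} :=
  (B :&: \bigcap_(i < n.+1) \bigcap_(k < n.+1 | (k < i + d)%N)
     lker (amulr (e k) \o amull (e i))%VF)%VS.

Lemma BgeP d b : reflect (Bge e B d b) (b \in Bge_space d).
Proof.
apply: (iffP idP) => [|[bB b0]].
  rewrite memv_cap => /andP[bB b0]; split=> // i k ik.
  move: b0; rewrite memvE => /subv_bigcapP/(_ i isT)/subv_bigcapP/(_ k ik).
  by rewrite -memvE memv_ker comp_lfunE amulrE amullE => /eqP.
rewrite memv_cap bB /= memvE; apply/subv_bigcapP => i _; apply/subv_bigcapP => k ik.
by rewrite -memvE memv_ker comp_lfunE amulrE amullE b0.
Qed.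

Variables (r : 'I_n.+1) (k : nat) (a : 'I_k -> A) (alpha : 'I_k -> 'End(A)).
Hypothesis dual : dual_basis_mod (J r) a alpha.

Let JJ : ideal (J r) := J_ideal e r.
Let er := estar_idem eG r.

Lemma alpha_in t x : alpha t x \in (B : {vspace A}). Proof. by case: dual. Qed.
Lemma alpha_mulr t x b : b \in (B : {vspace A}) -> alpha t (x * b) = alpha t x * b.
Proof. by case: dual => _ alM _ _; apply: alM. Qed.
Lemma alpha_J t x : x \in J r -> alpha t x = 0.
Proof. by case: dual => _ _ al0 _; apply: al0. Qed.
Lemma alpha_sum x : x - \sum_t a t * alpha t x \in J r.
Proof. by case: dual => _ _ _; apply. Qed.

(* Modulo [J r], the [psi t] are the coordinate maps of a dual basis [a t * e r]
   of the right [e r * A * e r]-module [A * e r]. *)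
Definition psi t x := e r * part e 0 (alpha t (x * e r)).

Lemma psi_e t x : psi t x * e r = psi t x.
Proof.
by rewrite /psi -mulrA -(H_comm eG r (part0_H eG hB (alpha_in _ _))) mulrA er.
Qed.

Lemma e_psi t x : e r * psi t x = psi t x. Proof. by rewrite /psi mulrA er. Qed.

(** Multiply the expansion of [x * e r] by [e r] on the right; [B_e_J] then replaces
    [alpha t (x * e r) * e r] by [e r] times its degree 0 part. *)
Lemma psi_sum x : x * e r - \sum_t a t * psi t x \in J r.
Proof.
have := ideal_mulr (e r) JJ (alpha_sum (x * e r)).
rewrite mulrBl -mulrA er mulr_suml => xJ.
have sJ : \sum_t (a t * alpha t (x * e r) * e r - a t * psi t x) \in J r.
  apply: rpred_sum => t _; rewrite -mulrA -mulrBr.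
  by rewrite (ideal_mull _ JJ) // (B_e_J eG hB) ?alpha_in.
have := rpredD xJ sJ; by rewrite sumrB addrA subrK.
Qed.

(** An exact equality and not a congruence, since [alpha t] kills [J r] and [part e 0] is
    multiplicative on [B]. At [x = a u] it says that the matrix [psi t (a s)] is idempotent. *)
Lemma psi_psi t x : \sum_s psi t (a s) * psi s x = psi t x.
Proof.
pose c s := part e 0 (alpha s (x * e r)).
have cH s : c s \in H by rewrite part0_H ?alpha_in.
have cB s := H_sub_B (cH s).
transitivity (\sum_s e r * part e 0 (alpha t (a s * e r * c s))).
  apply: eq_bigr => s _; rewrite alpha_mulr // (part0M eG hB) ?alpha_in // (part0_id eG (cH s)).
  by rewrite {2}/psi mulrA psi_e -mulrA.
rewrite -mulr_sumr -!linear_sum /psi; congr (_ * part e 0 _).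
have := alpha_J t (psi_sum x); rewrite linearB /= => /eqP; rewrite subr_eq0 => /eqP->.
by congr (alpha t _); apply: eq_bigr => s _; rewrite mulrA.
Qed.

(* [tau] is the composite of A -> A e_r (x) e_r B, [x |-> \sum a t e r (x) e r * alpha t x],
   with multiplication.  On [J r.+1 / J r] it is unipotent with respect to the
   filtration [filt] by the degree of the right factor. *)
Definition tau : 'End(A) := \sum_t (amull (a t * e r) \o alpha t)%VF.

Lemma tauE x : tau x = \sum_t a t * e r * alpha t x.
Proof. by rewrite sum_lfunE; apply: eq_bigr => t _; rewrite comp_lfunE amullE. Qed.

Lemma tau_J x : x \in J r -> tau x = 0.
Proof. by move=> xJ; rewrite tauE big1 // => t _; rewrite alpha_J // mulr0. Qed.

Lemma tau_mulr x b : b \in (B : {vspace A}) -> tau (x * b) = tau x * b.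
Proof.
move=> bB; rewrite !tauE mulr_suml; apply: eq_bigr => t _.
by rewrite alpha_mulr // mulrA.
Qed.

Lemma tau_JS x : tau x \in J r.+1.
Proof. by rewrite tauE; apply: rpred_sum => t _; apply: mem_JS. Qed.

Definition filt d : {vspace A} := (J r + fullv * <[e r]> * Bge_space d)%VS.

Lemma filt_sub d (W : {vspace A}) : (J r <= W)%VS ->
  (forall x b, Bge e B d b -> x * e r * b \in W) -> (filt d <= W)%VS.
Proof.
move=> JW xW; rewrite subv_add JW; apply/prodvP => _ b /mem_lideal[x ->] /BgeP.
exact: xW.
Qed.

Lemma mem_filt d x b : Bge e B d b -> x * e r * b \in filt d.
Proof.
move=> bd; apply: (subvP (addvSr _ _)).
by rewrite !memv_mul ?memvf ?memv_line //; apply/BgeP.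
Qed.

Lemma J_filt d x : x \in J r -> x \in filt d. Proof. exact/subvP/addvSl. Qed.

Lemma JS_filt0 : (J r.+1 <= filt 0)%VS.
Proof.
rewrite JS subv_add addvSl; apply: gen_by_sub => x y.
have -> : x * e r * y = x * (e r * y - e r * projB y) + x * e r * projB y.
  by rewrite mulrBr !mulrA subrK.
apply: rpredD; last by apply: mem_filt; apply: Bge0 => //; apply: projB_in.
by apply: J_filt; apply: ideal_mull => //; apply: (e_projB_J eG hB).
Qed.

Lemma filt_last : (filt n.+1 <= J r)%VS.
Proof. by apply: filt_sub => // x b /(Bge_eq0 eG)->; rewrite mulr0 mem0v. Qed.

(** The Nakayama step. On [x * e r * b], the degree 0 parts of the coefficients [alpha t (x * e r)]
    give back [x * e r * b] by [psi_sum]; the remainders [c t] have degree at least 1 and push [b]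
    one step up the filtration. *)
Lemma sub_tau_filt d x : x \in filt d -> x - tau x \in filt d.+1.
Proof.
pose D : 'End(A) := \1%VF - tau.
have DE y : D y = y - tau y by rewrite add_lfunE opp_lfunE id_lfunE.
rewrite -DE memv_preim; move: x; apply/subvP; apply: filt_sub.
  by apply/subvP => x xJ; rewrite -memv_preim DE tau_J // subr0 J_filt.
move=> x b bd; have [bB _] := bd; rewrite -memv_preim DE tau_mulr // tauE.
pose c t := alpha t (x * e r) - part e 0 (alpha t (x * e r)).
have cB t : Bge e B 1 (c t) by apply: Bge_sub_part0 => //; apply: alpha_in.
have -> : \sum_t a t * e r * alpha t (x * e r) =
    \sum_t a t * e r * c t + \sum_t a t * psi t x.
  by rewrite -big_split; apply: eq_bigr => t _; rewrite /= /psi mulrA -mulrDr subrK.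
rewrite mulrDl opprD addrCA addrC -mulrBl rpredD //.
  by apply: J_filt; apply: ideal_mulr => //; apply: psi_sum.
rewrite rpredN mulr_suml; apply: rpred_sum => t _; rewrite -mulrA.
rewrite -!mulrA mulrA; apply: mem_filt; exact: (Bge_mul eG).
Qed.

(** The powers of [1 - tau]; the one of exponent [n.+1] sends [J r.+1] into [J r]. *)
Fixpoint residue d : 'End(A) :=
  if d is d'.+1 then ((\1 - tau) \o residue d')%VF else \1%VF.

Lemma residueS d x : residue d.+1 x = residue d x - tau (residue d x).
Proof. by rewrite comp_lfunE add_lfunE opp_lfunE id_lfunE. Qed.

Lemma residue0 x : residue 0 x = x. Proof. exact: id_lfunE. Qed.

Lemma residue_filt d x : x \in filt 0 -> residue d x \in filt d.
Proof. by move=> xV; elim: d => [|d IH]; rewrite ?residue0 // residueS sub_tau_filt. Qed.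

Lemma residue_mulr d x b : b \in (B : {vspace A}) -> residue d (x * b) = residue d x * b.
Proof.
by move=> bB; elim: d => [|d IH]; rewrite ?residue0 // !residueS IH tau_mulr // mulrBl.
Qed.

Lemma residue_J d x : x \in J r -> residue d x = x.
Proof. by move=> xJ; elim: d => [|d IH]; rewrite ?residue0 // residueS IH tau_J ?subr0. Qed.

Lemma residue_JS x : x \in J r.+1 -> residue n.+1 x \in J r.
Proof. by move/(subvP JS_filt0)/(residue_filt n.+1); apply/subvP/filt_last. Qed.

(** The Neumann series for the inverse of [tau = 1 - (1 - tau)], cut off where the next power
    vanishes on [J r.+1 / J r]. *)
Definition neumann : 'End(A) := \sum_(d < n.+1) residue d.

Lemma neumann_tau x : x - tau (neumann x) = residue n.+1 x.
Proof.
suff gen (m : nat) : x - tau ((\sum_(d < m) residue d) x) = residue m x by exact: gen.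
elim: m => [|m IH]; first by rewrite big_ord0 zero_lfunE (tau_J (mem0v _)) subr0 residue0.
by rewrite big_ord_recr add_lfunE linearD opprD addrA IH residueS.
Qed.

Lemma neumann_J x : x \in J r -> neumann x \in J r.
Proof. by move=> xJ; rewrite sum_lfunE; apply: rpred_sum => d _; rewrite residue_J. Qed.

(** Modulo [J r], [residue n.+1] is a [B]-linear projection with kernel [J r.+1]. Hence [A / J r.+1]
    is a direct summand of [A / J r], and the same generators serve with the functionals composed
    with this projection. *)
Lemma dual_basis_modS : dual_basis_mod (J r.+1) a (fun t => alpha t \o residue n.+1)%VF.
Proof.
split=> [t x|t x b bB|t x xJ|x].
- by rewrite comp_lfunE alpha_in.
- by rewrite comp_lfunE [in RHS]comp_lfunE residue_mulr // alpha_mulr.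
- by rewrite comp_lfunE alpha_J // residue_JS.
under eq_bigr do rewrite comp_lfunE.
have xE : x - residue n.+1 x = tau (neumann x) by rewrite -neumann_tau opprB addrC subrK.
set sm := \sum_t _.
have -> : x - sm = (x - residue n.+1 x) + (residue n.+1 x - sm) by rewrite addrA subrK.
rewrite xE; apply: rpredD; first exact: tau_JS.
exact: (subvP (J_S_sub e r)) (alpha_sum _).
Qed.

(* Injectivity of [A e_r (x) e_r A -> A / J r]: the left factor is embedded in
   [(e_r A e_r)^k] by [psi], with image cut out by the idempotent matrix
   [psi t (a s)]. *)
Lemma psi_mulr_inj (Y : 'I_k -> A) :
  (forall t, Y t - \sum_s psi t (a s) * Y s \in J r) ->
  \sum_s a s * e r * Y s \in J r -> forall t, Y t \in J r.
Proof.
move=> Ypsi Ysum.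
(* By induction on [d], each [Y t] is [e r] times an element of [B] of degree at least [d], modulo
   [J r]; at [d = n.+1] that element is 0. *)
have eY d t : exists b, Bge e B d b /\ Y t - e r * b \in J r.
  elim: d t => [|d IH] t.
    pose y := \sum_s part e 0 (alpha t (a s * e r)) * Y s.
    have yE : \sum_s psi t (a s) * Y s = e r * y.
      by rewrite mulr_sumr; apply: eq_bigr => s _; rewrite mulrA.
    exists (projB y); split; first by apply: Bge0 => //; apply: projB_in.
    rewrite -(subrK (e r * y) (Y t)) -addrA; apply: rpredD; last exact: (e_projB_J eG hB).
    by rewrite -yE.
  case/fin_all_exists: IH => b bP.
  (* Apply [alpha t] to the relation. The degree 0 parts of its coefficients give [psi t (a s)], so
     [Y t] is congruent to minus [e r] times the sum of the [c s * b s], where [c s] has positive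
     degree. *)
  pose c s := alpha t (a s * e r) - part e 0 (alpha t (a s * e r)).
  exists (- \sum_s c s * b s); split.
    apply: Bge_opp; apply: Bge_sum => s; have [bs _] := bP s.
    by apply: (Bge_mul eG) => //; apply: Bge_sub_part0 => //; apply: alpha_in.
  have abJ : \sum_s a s * e r * b s \in J r.
    have -> : \sum_s a s * e r * b s =
        \sum_s a s * e r * Y s - \sum_s a s * e r * (Y s - e r * b s).
      rewrite -sumrB; apply: eq_bigr => s _.
      by rewrite mulrBr opprB addrC subrK !mulrA -(mulrA (a s) (e r) (e r)) er.
    apply: rpredB => //; apply: rpred_sum => s _; apply: ideal_mull => //.
    by have [] := bP s.
  have := alpha_J t abJ; rewrite linear_sum /= => al0.
  have bB s : b s \in (B : {vspace A}) by have [[]] := bP s.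
  have split0 : \sum_s psi t (a s) * (e r * b s) = - (e r * \sum_s c s * b s).
    apply/eqP; rewrite -addr_eq0 mulr_sumr -big_split /=; apply/eqP.
    apply: etrans _ (etrans (congr1 ( *%R (e r)) al0) (mulr0 _)).
    rewrite mulr_sumr; apply: eq_bigr => s _.
    rewrite mulrA psi_e /psi -[e r * _ * _]mulrA -mulrDr -mulrDl addrC subrK.
    by rewrite (alpha_mulr _ _ (bB s)).
  rewrite mulrN -split0.
  rewrite -(subrK (\sum_s psi t (a s) * Y s) (Y t)) -addrA; apply: rpredD => //.
  rewrite -sumrB; apply: rpred_sum => s _; rewrite -mulrBr; apply: ideal_mull => //.
  by have [] := bP s.
by move=> t; have [b [/(Bge_eq0 eG)-> ]] := eY n.+1 t; rewrite mulr0 subr0.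
Qed.

(* [neumann] inverts [tau] on [J r.+1 / J r]; on [x e_r y], [rcoord t] is [psi t x * y]. *)
Definition rcoord t : 'End(A) := \sum_s (amull (psi t (a s)) \o alpha s \o neumann)%VF.

Lemma rcoordE t x : rcoord t x = \sum_s psi t (a s) * alpha s (neumann x).
Proof.
rewrite sum_lfunE; apply: eq_bigr => s _.
by rewrite comp_lfunE [in LHS]comp_lfunE amullE.
Qed.

Lemma rcoord_J t x : x \in J r -> rcoord t x = 0.
Proof. by move=> xJ; rewrite rcoordE big1 // => s _; rewrite alpha_J ?mulr0 // neumann_J. Qed.

(** By [psi_mulr_inj] it is enough that the differences are fixed by the matrix [psi t (a s)], which
    is [psi_psi], and that both families have the same sum against the [a s * e r]. Both sums are
    [x * e r * y] modulo [J r]: the first through [tau (neumann z)], the second by [psi_sum]. *)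
Lemma rcoord_gen t x y : rcoord t (x * e r * y) - psi t x * y \in J r.
Proof.
move: t; apply: psi_mulr_inj => [t|].
  rewrite (_ : \sum_s _ = rcoord t (x * e r * y) - psi t x * y) ?subrr ?mem0v //.
  under eq_bigr do rewrite mulrBr mulrA rcoordE mulr_sumr.
  rewrite sumrB -mulr_suml psi_psi exchange_big rcoordE /=; congr (_ - _).
  apply: eq_bigr => s _; rewrite -(psi_psi t (a s)) mulr_suml.
  by apply: eq_bigr => u _; rewrite mulrA.
set z := x * e r * y; set w := neumann z.
have zJ : z - tau w \in J r by rewrite neumann_tau residue_JS // mem_JS.
have S1 : \sum_s a s * e r * rcoord s z - tau w \in J r.
  rewrite tauE (eq_bigr (fun s => \sum_u a s * psi s (a u) * alpha u w)) => [|s _].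
    rewrite exchange_big -sumrB; apply: rpred_sum => u _ /=.
    rewrite -mulr_suml -mulrBl -opprB mulNr rpredN.
    by apply: ideal_mulr => //; apply: psi_sum.
  by rewrite rcoordE mulr_sumr; apply: eq_bigr => u _; rewrite mulrA -(mulrA (a s)) e_psi.
have S2 : z - \sum_s a s * e r * (psi s x * y) \in J r.
  rewrite (eq_bigr (fun s => a s * psi s x * y)) => [|s _].
    by rewrite -mulr_suml -mulrBl; apply: ideal_mulr => //; apply: psi_sum.
  by rewrite [LHS]mulrA -(mulrA (a s) (e r)) e_psi.
under eq_bigr do rewrite mulrBr.
rewrite sumrB; set s1 := \sum_s _ in S1 *; set s2 := \sum_s _ in S2 *.
have -> : s1 - s2 = (s1 - tau w) - (z - tau w) + (z - s2).
  by rewrite opprB !addrA !subrK.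
by apply: rpredD => //; apply: rpredB.
Qed.

End Stage.

(** * Left coordinates on [J r.+1] modulo [J r] *)

Section LeftMaps.
Variables (K : fieldType) (A : falgType K) (n : nat) (e : 'I_n.+1 -> A).
Variable B : {aspace A}.
Hypotheses (eG : idem_grading e) (hB : pre_borelic e B).
Implicit Types (x y z b c m : A).

Notation H := ((B : {vspace A}) :&: Agr e 0)%VS.
Notation J := (J e).
Notation projB := (projB e B).
Notation h := (h e B).

Variables (r : 'I_n.+1) (k : nat) (a : 'I_k -> A) (alpha : 'I_k -> 'End(A)).
Hypothesis dual : dual_basis_mod B (J r) a alpha.
Variables (kl : nat) (d : 'I_kl -> A) (beta : 'I_kl -> 'End(A)).
Hypotheses (beta_in : forall u x, x \in (B : {vspace A}) -> beta u x \in H)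
  (beta_mull : forall u x c, x \in (B : {vspace A}) -> c \in H -> beta u (c * x) = c * beta u x)
  (beta_sum : forall x, x \in (B : {vspace A}) -> x = \sum_u beta u x * d u).

Notation rcoord := (rcoord e r a alpha).
Notation psi := (psi e r alpha).

Let JJ : ideal (J r) := J_ideal e r.
Let er := estar_idem eG r.

Lemma h_mul_in x : x \in (B : {vspace A}) -> h r * x \in (B : {vspace A}).
Proof. by move=> xB; rewrite memvM ?(H_sub_B (h_H eG hB r)). Qed.

(** Coordinates, modulo [J r], of the left [e_r A e_r]-module [e_r A] for the generators
    [e r * d u]: pass to [h_r B], where [J r] becomes exactly 0, take coordinates over [H], and
    return by [e r]. *)
Definition phi u : 'End(A) := (amull (e r) \o beta u \o amull (h r) \o projB \o amull (e r))%VF.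

Lemma phiE u y : phi u y = e r * beta u (h r * projB (e r * y)).
Proof.
rewrite comp_lfunE [in LHS]comp_lfunE [in LHS]comp_lfunE [in LHS]comp_lfunE.
by rewrite (amullE (e r) y) (amullE (h r)) amullE.
Qed.

Lemma phi_J u y : y \in J r -> phi u y = 0.
Proof.
move=> yJ; rewrite phiE (h_projB_J eG hB (ltnW (ltn_ord r)) (ideal_mull (e r) JJ yJ)) //.
by rewrite linear0 mulr0.
Qed.

(** [psi t x] is [e r * c] with [c] in [H]; such a [c] commutes with [e r] and [h r] and passes
    through [projB] and [beta u]. *)
Lemma phi_psi u t x y : phi u (psi t x * y) = psi t x * phi u y.
Proof.
rewrite !phiE /psi; set c := part e 0 _.
have cH : c \in H by apply: part0_H => //; apply: (alpha_in dual).
have ce := H_comm eG r cH.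
have -> : e r * (e r * c * y) = c * (e r * y) by rewrite !mulrA er ce.
rewrite (projB_mull eG hB _ cH) (mulrA (h r)) (h_comm eG hB r cH) -[c * h r * _]mulrA.
rewrite beta_mull ?h_mul_in ?(projB_in e B) // [RHS]mulrA -(mulrA (e r) c (e r)) -ce.
by rewrite (mulrA (e r) (e r) c) er mulrA.
Qed.

Lemma phi_e u y : phi u y * e r = phi u y.
Proof.
rewrite phiE -mulrA -(H_comm eG r (beta_in u (h_mul_in (projB_in e B _)))).
by rewrite mulrA er.
Qed.

Lemma e_phi u y : e r * phi u y = phi u y.
Proof. by rewrite phiE mulrA er. Qed.

Lemma phi_sum y : e r * y - \sum_u phi u y * d u \in J r.
Proof.
under eq_bigr do rewrite phiE -mulrA.
rewrite -mulr_sumr -beta_sum ?h_mul_in ?(projB_in e B) //; set w := e r * y.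
have -> : w - e r * (h r * projB w) =
  (e r * w - e r * projB w) + (e r * projB w - e r * (h r * projB w)).
  by rewrite /w mulrA er addrA subrK.
by rewrite rpredD ?(e_projB_J eG hB) ?(e_H_h_J eG hB) ?(projB_in e B).
Qed.

(* On [x e_r y], [lcoord u] is [x e_r * phi u y]. *)
Definition lcoord u : 'End(A) := \sum_t (amull (a t) \o phi u \o rcoord t)%VF.

Lemma lcoordE u x : lcoord u x = \sum_t a t * phi u (rcoord t x).
Proof.
rewrite sum_lfunE; apply: eq_bigr => t _.
by rewrite comp_lfunE [in LHS]comp_lfunE amullE.
Qed.

Lemma lcoord_J u x : x \in J r -> lcoord u x = 0.
Proof. by move=> xJ; rewrite lcoordE big1 // => t _; rewrite (rcoord_J dual) // linear0 mulr0. Qed.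

(** [phi u] kills [J r], so it turns the congruence [rcoord_gen] into an equality; after [phi_psi],
    [psi_sum] reassembles [x * e r]. *)
Lemma lcoord_gen u x y : lcoord u (x * e r * y) - x * e r * phi u y \in J r.
Proof.
have -> : lcoord u (x * e r * y) = \sum_t a t * psi t x * phi u y.
  rewrite lcoordE; apply: eq_bigr => t _.
  have := phi_J u (rcoord_gen eG hB dual t x y); rewrite linearB /= => /eqP.
  by rewrite subr_eq0 => /eqP->; rewrite phi_psi mulrA.
rewrite -mulr_suml -mulrBl -opprB mulNr rpredN.
by apply: ideal_mulr => //; apply: (psi_sum eG hB dual).
Qed.

Lemma JS_ind (g : 'End(A)) (W : {vspace A}) :
  (forall x, x \in J r -> g x \in W) -> (forall x y, g (x * e r * y) \in W) ->
  forall x, x \in J r.+1 -> g x \in W.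
Proof.
move=> gJ ge x; rewrite [g x \in W]memv_preim; move: x; apply/subvP.
rewrite JS subv_add; apply/andP; split; first by apply/subvP => x /gJ; rewrite memv_preim.
by apply: gen_by_sub => x y; rewrite -memv_preim.
Qed.

Lemma rcoord_sum x : x \in J r.+1 -> x - \sum_t a t * e r * rcoord t x \in J r.
Proof.
pose g : 'End(A) := (\1 - \sum_t (amull (a t * e r) \o rcoord t))%VF.
have gE y : g y = y - \sum_t a t * e r * rcoord t y.
  rewrite add_lfunE opp_lfunE id_lfunE sum_lfunE; congr (_ - _).
  by apply: eq_bigr => t _; rewrite comp_lfunE amullE.
rewrite -gE; move: x; apply: JS_ind => [x xJ|x y]; rewrite gE.
  by rewrite big1 ?subr0 // => t _; rewrite (rcoord_J dual) ?mulr0.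
set z := x * e r * y; set s := \sum_t _.
have -> : z - s = (x * e r - \sum_t a t * psi t x) * y
                - \sum_t a t * e r * (rcoord t z - psi t x * y).
  rewrite mulrBl -/z mulr_suml -addrA -opprD -big_split /=; congr (_ - _).
  apply: eq_bigr => t _; rewrite mulrBr (mulrA (a t * e r)) -(mulrA (a t) (e r) (psi t x)).
  by rewrite (e_psi eG) addrC subrK.
apply: rpredB; first by apply: ideal_mulr => //; apply: (psi_sum eG hB dual).
by apply: rpred_sum => t _; apply: ideal_mull => //; apply: (rcoord_gen eG hB dual).
Qed.

Lemma rcoord_mulr t x c : x \in J r.+1 -> rcoord t (x * c) - rcoord t x * c \in J r.
Proof.
pose g : 'End(A) := ((rcoord t \o amulr c) - (amulr c \o rcoord t))%VF.
have gE y : g y = rcoord t (y * c) - rcoord t y * c.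
  rewrite add_lfunE opp_lfunE comp_lfunE [X in _ - X]comp_lfunE.
  by rewrite (amulrE c y) amulrE.
rewrite -gE; move: x; apply: JS_ind => [x xJ|x y]; rewrite gE.
  by rewrite !(rcoord_J dual) ?mul0r ?subr0 ?mem0v // ideal_mulr.
have -> : rcoord t (x * e r * y * c) - rcoord t (x * e r * y) * c =
  (rcoord t (x * e r * (y * c)) - psi t x * (y * c)) - (rcoord t (x * e r * y) - psi t x * y) * c.
  by rewrite mulrBl opprB !mulrA addrA subrK.
apply: rpredB; first exact: (rcoord_gen eG hB dual).
by apply: ideal_mulr => //; exact: (rcoord_gen eG hB dual).
Qed.

Lemma lcoord_sum x : x \in J r.+1 -> x - \sum_u lcoord u x * (e r * d u) \in J r.
Proof.
pose g : 'End(A) := (\1 - \sum_u (amulr (e r * d u) \o lcoord u))%VF.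
have gE y : g y = y - \sum_u lcoord u y * (e r * d u).
  rewrite add_lfunE opp_lfunE id_lfunE sum_lfunE; congr (_ - _).
  by apply: eq_bigr => t _; rewrite comp_lfunE amulrE.
rewrite -gE; move: x; apply: JS_ind => [x xJ|x y]; rewrite gE.
  by rewrite big1 ?subr0 // => t _; rewrite lcoord_J ?mul0r.
set z := x * e r * y; set s := \sum_u _.
have -> : z - s = x * (e r * y - \sum_u phi u y * d u)
                - \sum_u (lcoord u z - x * e r * phi u y) * (e r * d u).
  rewrite mulrBr (mulrA x (e r) y) -/z mulr_sumr -addrA -opprD -big_split /=; congr (_ - _).
  apply: eq_bigr => u _.
  have -> : (lcoord u z - x * e r * phi u y) * (e r * d u) =
    lcoord u z * (e r * d u) - x * (phi u y * d u).
    rewrite mulrBl; congr (_ - _); rewrite [LHS]mulrA -(mulrA (x * e r) _ (e r)) phi_e.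
    by rewrite -(mulrA x (e r)) e_phi -mulrA.
  by rewrite addrC subrK.
apply: rpredB; first by apply: ideal_mull => //; apply: phi_sum.
by apply: rpred_sum => t _; apply: ideal_mulr => //; apply: lcoord_gen.
Qed.

Lemma lcoord_mull u x c : x \in J r.+1 -> lcoord u (c * x) - c * lcoord u x \in J r.
Proof.
pose g : 'End(A) := ((lcoord u \o amull c) - (amull c \o lcoord u))%VF.
have gE y : g y = lcoord u (c * y) - c * lcoord u y.
  rewrite add_lfunE opp_lfunE comp_lfunE [X in _ - X]comp_lfunE.
  by rewrite (amullE c y) amullE.
rewrite -gE; move: x; apply: JS_ind => [x xJ|x y]; rewrite gE.
  by rewrite !lcoord_J ?mulr0 ?subr0 ?mem0v // ideal_mull.
have -> : lcoord u (c * (x * e r * y)) - c * lcoord u (x * e r * y) =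
  (lcoord u (c * x * e r * y) - c * x * e r * phi u y)
  - c * (lcoord u (x * e r * y) - x * e r * phi u y).
  by rewrite mulrBr opprB !mulrA addrA subrK.
apply: rpredB; first exact: lcoord_gen.
by apply: ideal_mull => //; exact: lcoord_gen.
Qed.

End LeftMaps.

(** * Projectivity of the image of an ideal in a quotient algebra *)

Section Transport.
Variables (K : fieldType) (A C : falgType K) (f : 'AHom(A, C)) (I M : {vspace A}).
Hypotheses (fT : limg f = fullv) (fI : lker f = I).
Variables (k : nat) (g : 'I_k -> A) (S : 'I_k -> 'End(A)).
Hypotheses (idM : ideal M) (gM : forall t, g t \in M) (SI : forall t x, x \in I -> S t x = 0).

Let ffV z : f ((f^-1)%VF z) = z.
Proof. by rewrite limg_lfunVK // fT memvf. Qed.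

Let f_eq x y : x - y \in I -> f x = f y.
Proof. by rewrite -fI memv_ker linearB subr_eq0 => /eqP. Qed.

Let SfV t x : S t ((f^-1)%VF (f x)) = S t x.
Proof.
apply/eqP; rewrite -subr_eq0 -linearB /= SI // -fI memv_ker linearB /= ffV.
by rewrite subrr.
Qed.

Let coords : exists s : 'Hom(C, {ffun 'I_k -> C}), forall z t, s z t = f (S t ((f^-1)%VF z)).
Proof.
have [|s sE] := @linear_homE _ C {ffun 'I_k -> C} (fun z => [ffun t => f (S t ((f^-1)%VF z))]).
  by move=> c x y; apply/ffunP => t; rewrite !ffunE !linearP.
by exists s => z t; rewrite sE ffunE.
Qed.

(** The maps [S t] vanish on the kernel of [f], so they descend to [C] whatever preimage [f^-1]
    picks, and the congruences modulo [I] become the equations of a dual basis. *)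
Lemma projective_right_img :
  (forall x, x \in M -> x - \sum_t g t * S t x \in I) ->
  (forall t x c, x \in M -> S t (x * c) - S t x * c \in I) ->
  projective_right fullv (f @: M)%VS.
Proof.
move=> Ssum Smul; split.
  by case: idM => _ MA; rewrite -fT -aimgM limgS.
have [s sE] := coords.
have [|p pE] := @linear_homE _ {ffun 'I_k -> C} C (fun x => \sum_t f (g t) * x t).
  move=> c x y; rewrite scaler_sumr -big_split; apply: eq_bigr => t _ /=.
  by rewrite !ffunE mulrDr scalerAr.
exists k, p, s; split=> [x _|z _ t|c x _ _|c _ _ /memv_imgP[x xM ->]|_ /memv_imgP[x xM ->]].
- rewrite pE; apply: rpred_sum => t _; rewrite -[x t]ffV -rmorphM memv_img //.
  by rewrite (ideal_mulr _ idM).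
- exact: memvf.
- by rewrite !pE mulr_suml; apply: eq_bigr => t _; rewrite ffunE mulrA.
- apply/ffunP => t; rewrite ffunE !sE -[c]ffV -rmorphM !SfV -rmorphM.
  by apply: f_eq; apply: Smul.
rewrite pE [RHS](f_eq (Ssum x xM)) rmorph_sum; apply: eq_bigr => t _.
by rewrite sE SfV -rmorphM.
Qed.

Lemma projective_left_img :
  (forall x, x \in M -> x - \sum_t S t x * g t \in I) ->
  (forall t x c, x \in M -> S t (c * x) - c * S t x \in I) ->
  projective_left fullv (f @: M)%VS.
Proof.
move=> Ssum Smul; split.
  by case: idM => AM _; rewrite -fT -aimgM limgS.
have [s sE] := coords.
have [|p pE] := @linear_homE _ {ffun 'I_k -> C} C (fun x => \sum_t x t * f (g t)).
  move=> c x y; rewrite scaler_sumr -big_split; apply: eq_bigr => t _ /=.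
  by rewrite !ffunE mulrDl scalerAl.
exists k, p, s; split=> [x _|z _ t|c x _ _|c _ _ /memv_imgP[x xM ->]|_ /memv_imgP[x xM ->]].
- rewrite pE; apply: rpred_sum => t _; rewrite -[x t]ffV -rmorphM memv_img //.
  by rewrite (ideal_mull _ idM).
- exact: memvf.
- by rewrite !pE mulr_sumr; apply: eq_bigr => t _; rewrite ffunE mulrA.
- apply/ffunP => t; rewrite ffunE !sE -[c]ffV -rmorphM !SfV -rmorphM.
  by apply: f_eq; apply: Smul.
rewrite pE [RHS](f_eq (Ssum x xM)) rmorph_sum; apply: eq_bigr => t _.
by rewrite sE SfV -rmorphM.
Qed.

End Transport.

(** * Standardly based direct factors *)

Lemma mulmx_zero_divisor (K : fieldType) m1 m2 m3 m4 (P : 'M[K]_(m1, m2)) (Q : 'M[K]_(m3, m4)) :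
  (forall X, P *m X *m Q = 0) -> P = 0 \/ Q = 0.
Proof.
move=> PQ; have PQe i j k l : P k i * Q j l = 0.
  (* A matrix unit, written as column times row, so that the product becomes a column of [P] times a
     row of [Q]. *)
  have := PQ (delta_mx i (0 : 'I_1) *m delta_mx (0 : 'I_1) j).
  rewrite (mulmxA P) -[P *m _ *m _ *m Q]mulmxA -colE -rowE.
  by move/matrixP/(_ k l); rewrite !mxE big_ord1 !mxE.
have [->|/matrix0Pn[j [l Qjl]]] := eqVneq Q 0; [by right | left].
by apply/matrixP => k i; apply: (mulIf Qjl); rewrite PQe mxE mul0r.
Qed.

(* A central idempotent acts on [W (x) W'] in the same way from both sides, hence
   by 0 or 1. *)
Lemma intertwined_idempotents (K : fieldType) m m' (P : 'M[K]_m) (Q : 'M[K]_m') (X0 : 'M_(m, m')) :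
  P *m P = P -> Q *m Q = Q -> (forall X, P *m X = X *m Q) -> P *m X0 != 0 ->
  P = 1%:M /\ Q = 1%:M.
Proof.
move=> PP QQ PQ X0n.
have [|P1|Q0] := @mulmx_zero_divisor K _ _ _ _ (1%:M - P) Q.
- by move=> X; rewrite -mulmxA -PQ mulmxA mulmxBl mul1mx PP subrr mul0mx.
- have [|P0|Q1] := @mulmx_zero_divisor K _ _ _ _ P (1%:M - Q).
  + by move=> X; rewrite PQ -mulmxA mulmxBr mulmx1 QQ subrr mulmx0.
  + by rewrite P0 mul0mx eqxx in X0n.
  by split; apply/eqP; rewrite eq_sym -subr_eq0 ?P1 ?Q1.
by rewrite PQ Q0 mulmx0 eqxx in X0n.
Qed.

Section StdBasedImage.
Variables (K : fieldType) (A C : falgType K) (S : {vspace A}) (h : A) (g : 'Hom(A, C)).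
Hypotheses (S1 : 1 \in S) (SM : forall x y, x \in S -> y \in S -> x * y \in S).
Hypotheses (hS : h \in S) (hh : h * h = h) (hC : forall x, x \in S -> h * x = x * h).
Hypotheses (gM : forall x y, x \in S -> y \in S -> g (x * y) = g x * g y)
           (g0 : forall x, x \in S -> (g x == 0) = (h * x == 0)).
Implicit Types x y : A.

Let g_h x : x \in S -> g (h * x) = g x.
Proof.
move=> xS; apply/eqP; rewrite -subr_eq0 -linearB /= g0; last by apply: rpredB => //; apply: SM.
by rewrite mulrBr mulrA hh subrr.
Qed.

(** On [S], [g x] determines [h * x]. Composing with [s] carries the maps [rho], [sig] and [psi]
    over to the image. *)
Lemma section_on_image : exists s : 'Hom(C, A), forall x, x \in S -> s (g x) = h * x.
Proof.
pose g2 := (g \o projv S)%VF.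
exists (amull h \o (projv S \o g2^-1))%VF => x xS.
rewrite comp_lfunE amullE comp_lfunE; apply/eqP; rewrite -subr_eq0 -mulrBr.
have pS : projv S ((g2^-1)%VF (g x)) \in S by apply: memv_proj.
rewrite -g0 ?rpredB // linearB subr_eq0 /=.
have gx : g x \in limg g2 by apply/memv_imgP; exists x; rewrite ?memvf // comp_lfunE projv_id.
by have := limg_lfunVK gx; rewrite {1}comp_lfunE => ->.
Qed.

(** Keep the poset and take images of the ideals. As [h] is central, each layer is killed by [h] or
    by [1 - h]: [g] collapses the first kind, whose complement becomes 0, and preserves the
    second. *)
Lemma std_based_img : std_based S 1 -> std_based (g @: S)%VS (g 1).
Proof.
case=> L [le [Ageq [Ap]]] /=; set lt := fun p q => le p q && (p != q).
rewrite -/lt; case=> -[leR leA leT] AgeqS [Ageq_lt Ap_compl] [Ap_sum Ap_dim] reps.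
pose Agt p := (\sum_(q | lt p q) Ageq q)%VS.
have subS p x : x \in Ageq p -> x \in S by have [/subvP H _ _] := AgeqS p; apply: H.
have mulL p x y : x \in S -> y \in Ageq p -> x * y \in Ageq p.
  by move=> xS yA; have [_ /subvP H _] := AgeqS p; apply: H; rewrite memv_mul.
have mulR p x y : x \in Ageq p -> y \in S -> x * y \in Ageq p.
  by move=> xA yS; have [_ _ /subvP H] := AgeqS p; apply: H; rewrite memv_mul.
have AgtE p : (Ap p + Agt p)%VS = Ageq p by have [] := Ap_compl p.
have Agt_dir p : (Ap p :&: Agt p)%VS = 0%VS by have [] := Ap_compl p.
have Agt_sub p : (Agt p <= Ageq p)%VS by rewrite -AgtE addvSr.
have Ap_sub p : (Ap p <= Ageq p)%VS by rewrite -AgtE addvSl.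
have mulL' p x y : x \in S -> y \in Agt p -> x * y \in Agt p.
  move=> xS; rewrite -(amullE x) memv_preim; move: y; apply/subvP/subv_sumP => q pq.
  apply/subvP => y yA; rewrite -memv_preim amullE.
  by apply: (subvP (sumv_sup q pq (subvv _))); apply: mulL.
(* [D p]: [h] acts by 0 on [Ageq p / Agt p]; otherwise [1 - h] does. *)
pose D p := (amull h @: Ageq p <= Agt p)%VS.
have DP p : reflect (forall x, x \in Ageq p -> h * x \in Agt p) (D p).
  apply: (iffP subvP) => [DA x xA|DA _ /memv_imgP[x xA ->]]; last by rewrite amullE DA.
  by rewrite -amullE; apply: DA; rewrite memv_img.
have NDP p : ~~ D p -> exists (m m' : nat) (rho : 'Hom(A, 'M[K]_m))
                  (sig : 'Hom(A, 'M[K]_m')) (psi : 'Hom(A, 'M[K]_(m, m'))),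
    [/\ (forall a b, a \in S -> b \in S -> rho (a * b) = rho a *m rho b)
              /\ rho h = 1%:M,
            (forall a b, a \in S -> b \in S -> sig (a * b) = sig a *m sig b)
              /\ sig h = 1%:M,
            (psi @: Ageq p = fullv)%VS,
            (lker psi :&: Ageq p = Agt p)%VS &
            forall a x, a \in S -> x \in Ageq p ->
              psi (a * x) = rho a *m psi x /\ psi (x * a) = psi x *m sig a].
  move=> ND; have [m [m' [rho [sig [psi [[rhoM rho1] [sigM sig1] psiT psiK psiM]]]]]] := reps p.
  exists m, m', rho, sig, psi.
  have [x xA hx] : exists2 x, x \in Ageq p & h * x \notin Agt p.
    case/subvPn: ND => _ /memv_imgP[x xA ->]; rewrite amullE => hx.
    by exists x.
  have [||||-> ->] // := @intertwined_idempotents _ _ _ (rho h) (sig h) (psi x).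
  - by rewrite -rhoM ?hh.
  - by rewrite -sigM ?hh.
  - move=> X; have : X \in fullv by apply: memvf.
    rewrite -psiT => /memv_imgP[y yA ->]; have [<- <-] := psiM h y hS yA.
    by rewrite hC // (subS p).
  have [<- _] := psiM h x hS xA; apply: contra hx => hx.
  by rewrite -[Agt p]psiK memv_cap memv_ker hx mulL.
have NDP' p x : ~~ D p -> x \in Ageq p -> x - h * x \in Agt p.
  move=> ND xA; have [m [m' [rho [sig [psi [[_ rhoh] _ _ psiK psiM]]]]]] := NDP p ND.
  rewrite -psiK memv_cap memv_ker linearB /= (psiM h x hS xA).1 rhoh mul1mx subrr eqxx /=.
  by apply: rpredB => //; apply: mulL.
have gAgt p : (\sum_(q | lt p q) g @: Ageq q)%VS = (g @: Agt p)%VS by rewrite limg_sum.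
(* Induction on the number of elements above [p]. It serves twice: for [g] and the layers killed by
   [h], and for multiplication by [1 - h] and the other layers. *)
have span_cut (E : falgType K) (g' : 'Hom(A, E)) (D' : pred L) :
  (forall p, D' p -> (g' @: Ageq p <= g' @: Agt p)%VS) ->
  (g' @: S = \sum_(p | ~~ D' p) g' @: Ap p)%VS.
  move=> D'P; apply/eqP; rewrite eqEsubv; apply/andP; split; last first.
    apply/subv_sumP => p _; apply: limgS; apply/subvP => x /(subvP (Ap_sub p)).
    exact: subS.
  have Ageq_le p : (g' @: Ageq p <= \sum_(p | ~~ D' p) g' @: Ap p)%VS.
    have [N] := ubnP #|[pred q | lt p q]|; elim: N p => // N IH p pN.
    have gt_le : (g' @: Agt p <= \sum_(p | ~~ D' p) g' @: Ap p)%VS.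
      rewrite limg_sum; apply/subv_sumP => q pq; apply: IH.
      rewrite ltnS in pN; apply: leq_trans pN; apply: proper_card; apply/properP; split.
        apply/subsetP => q'; rewrite !inE /lt; case/andP: pq => pq npq /andP[qq' nqq'].
        rewrite (leT _ _ _ pq qq') /=; apply: contraNneq npq => pq'.
        by apply/eqP/leA; rewrite pq {1}pq'.
      by exists q; rewrite !inE // /lt eqxx andbF.
    have [Dp|NDp] := boolP (D' p); first exact: subv_trans (D'P p Dp) gt_le.
    by rewrite -AgtE limgD subv_add gt_le (sumv_sup p).
  rewrite -Ap_sum limg_sum; apply/subv_sumP => p _.
  exact: subv_trans (limgS _ (Ap_sub p)) (Ageq_le p).
have gD p : D p -> (g @: Ageq p <= g @: Agt p)%VS.
  move=> /DP Dp; apply/subvP => _ /memv_imgP[x xA ->].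
  by rewrite -g_h ?(subS p) // memv_img ?Dp.
pose Ap' p := (if D p then 0 else g @: Ap p)%VS.
have Ap'_sum : (\sum_p Ap' p = g @: S)%VS.
  rewrite (span_cut _ g D gD) [RHS]big_mkcond; apply: eq_bigr => p _.
  by rewrite /Ap'; case: (D p).
have [s sE] := section_on_image.
exists L, le, (fun p => g @: Ageq p)%VS, Ap' => /=; rewrite -/lt.
split=> [|p||| p].
- by [].
- split; first by have [? _ _] := AgeqS p; rewrite limgS.
    apply/prodvP => _ _ /memv_imgP[x xS ->] /memv_imgP[y yA ->].
    by rewrite -(gM xS (subS p y yA)) memv_img ?mulL.
  apply/prodvP => _ _ /memv_imgP[x xA ->] /memv_imgP[y yS ->].
  by rewrite -(gM (subS p x xA) yS) memv_img ?mulR.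
- split=> [p q pq|p]; first by rewrite limgS ?Ageq_lt.
  rewrite gAgt /Ap'; case: (boolP (D p)) => [Dp|NDp].
    rewrite add0v cap0v; split=> //; apply/eqP.
    by rewrite eqEsubv gD // limgS.
  split; first by rewrite -limgD AgtE.
  apply/eqP; rewrite -subv0; apply/subvP => _ /[!memv_cap]/andP[/memv_imgP[a aA ->]].
  case/memv_imgP=> t tA gat; have aA' := subvP (Ap_sub p) a aA.
  have tA' := subvP (Agt_sub p) t tA.
  suff aT : a \in Agt p.
    have : a \in (Ap p :&: Agt p)%VS by rewrite memv_cap aA.
    by rewrite Agt_dir !memv0 => /eqP->; rewrite linear0.
  rewrite -(subrK (h * a) a); apply: rpredD; first exact: NDP'.
  suff -> : h * a = h * t by apply: mulL'.
  have atS : a - t \in S by apply: rpredB; apply: (subS p).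
  by apply/eqP; rewrite -subr_eq0 -mulrBr -g0 // linearB /= gat subrr.
- split=> //; apply/eqP; rewrite eqn_leq dimv_leq_sum Ap'_sum /=.
  (* Dimension count: the kernel of [g] on [S] lies in [(1 - h) * S], spanned by the images of the
     [Ap p] with [D p]. So [g] loses at most their total dimension, and the remaining images are
     independent. *)
  pose g' := amull (1 - h).
  have g'D p : ~~ D p -> (g' @: Ageq p <= g' @: Agt p)%VS.
    move=> ND; apply/subvP => _ /memv_imgP[x xA ->].
    have -> : g' x = g' (x - h * x); last by rewrite memv_img ?NDP'.
    have hx0 : h * (x - h * x) = 0 by rewrite mulrBr mulrA hh subrr.
    by rewrite !amullE !mulrBl hx0 !mul1r subr0.
  have dim_ker : (\dim (S :&: lker g) <= \sum_(p | D p) \dim (Ap p))%N.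
    apply: (@leq_trans (\dim (g' @: S)%VS)).
      apply: dimvS; apply/subvP => x; rewrite memv_cap memv_ker => /andP[xS].
      rewrite g0 // => /eqP hx; have -> : x = g' x by rewrite amullE mulrBl hx mul1r subr0.
      by rewrite memv_img.
    rewrite (span_cut _ g' (fun p => ~~ D p) g'D).
    apply: (leq_trans (dimv_leq_sum _ _ _)).
    under eq_bigl do rewrite negbK.
    by apply: leq_sum => p _; rewrite -(limg_ker_dim g' (Ap p)) leq_addl.
  have Ap'_dim : (\sum_p \dim (Ap' p) <= \sum_(p | ~~ D p) \dim (Ap p))%N.
    rewrite [X in (_ <= X)%N]big_mkcond; apply: leq_sum => p _; rewrite /Ap'.
    by case: (D p); rewrite ?dimv0 // -(limg_ker_dim g (Ap p)) leq_addl.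
  have dimS : \dim S = (\sum_(p | D p) \dim (Ap p) + \sum_(p | ~~ D p) \dim (Ap p))%N.
    by rewrite -{1}Ap_sum Ap_dim (bigID D).
  apply: leq_trans Ap'_dim _; move: dim_ker (limg_ker_dim g S); rewrite dimS; lia.
have [Dp|NDp] := boolP (D p).
  (* A collapsed layer has zero quotient, realised by matrices of size 0, where even the unit
     condition is trivial. *)
  exists 0%N, 0%N, 0, 0, 0; split.
  - by split=> [x y _ _|]; rewrite [LHS]flatmx0 [RHS]flatmx0.
  - by split=> [x y _ _|]; rewrite [LHS]flatmx0 [RHS]flatmx0.
  - apply/eqP; rewrite eqEsubv subvf; apply/subvP => x _.
    by rewrite [x]flatmx0 mem0v.
  - rewrite gAgt; apply/eqP; rewrite eqEsubv subv_cap limgS //=.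
    apply/andP; split; first exact: subv_trans (capvSr _ _) (gD p Dp).
    by rewrite andbT; apply/subvP => x _; rewrite memv_ker zero_lfunE.
  by move=> x y _ _; split; rewrite [LHS]flatmx0 [RHS]flatmx0.
have [m [m' [rho [sig [psi [[rhoM rhoh] [sigM sigh] psiT psiK psiM]]]]]] := NDP p NDp.
have hxS x : x \in S -> h * x \in S by apply: SM.
have rho_h x : x \in S -> rho (h * x) = rho x by move=> xS; rewrite rhoM // rhoh mul1mx.
have sig_h x : x \in S -> sig (h * x) = sig x by move=> xS; rewrite sigM // sigh mul1mx.
have psi_s x : x \in Ageq p -> psi (s (g x)) = psi x.
  by move=> xA; rewrite sE ?(subS p) // (psiM h x hS xA).1 rhoh mul1mx.
exists m, m', (rho \o s)%VF, (sig \o s)%VF, (psi \o s)%VF; split.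
- split=> [_ _ /memv_imgP[x xS ->] /memv_imgP[y yS ->]|].
    by rewrite -gM // !comp_lfunE !sE ?SM // !rho_h ?SM // rhoM.
  by rewrite comp_lfunE sE // mulr1.
- split=> [_ _ /memv_imgP[x xS ->] /memv_imgP[y yS ->]|].
    by rewrite -gM // !comp_lfunE !sE ?SM // !sig_h ?SM // sigM.
  by rewrite comp_lfunE sE // mulr1.
- apply/eqP; rewrite eqEsubv subvf -psiT; apply/subvP => _ /memv_imgP[x xA ->].
  by rewrite -psi_s // -comp_lfunE !memv_img.
- rewrite gAgt; apply/vspaceP => y; rewrite memv_cap memv_ker; apply/andP/idP => [[yK]|].
    case/memv_imgP=> x xA yx; rewrite yx memv_img // -psiK memv_cap memv_ker xA andbT.
    by move: yK; rewrite yx comp_lfunE psi_s.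
  case/memv_imgP=> x xA ->; have xA' := subvP (Agt_sub p) x xA.
  rewrite comp_lfunE psi_s // memv_img //; split=> //.
  by move: xA; rewrite -psiK memv_cap memv_ker => /andP[].
move=> _ _ /memv_imgP[x xS ->] /memv_imgP[y yA ->].
have yS := subS p y yA; have [Ml Mr] := psiM x y xS yA.
rewrite -!gM // !comp_lfunE !(psi_s _ (mulL _ _ _ xS yA)) !(psi_s _ (mulR _ _ _ yA xS)).
rewrite (psi_s y yA).
by rewrite (sE x xS) rho_h // sig_h.
Qed.

End StdBasedImage.

(** * Primitive idempotents *)

Section Idempotents.
Variables (K : fieldType) (A : falgType K).
Implicit Types (e f g u v w x y z p q : A).

Lemma primitive_idem_idem e : primitive_idem e -> idempotent e.
Proof. by case. Qed.

(** Right multiplication by [v] maps [A f] onto [A e], with inverse right multiplication by [u]. *)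
Lemma idem_equiv_of_factor e f u v : u * v = e -> v * u = f ->
  e * u = u -> v * e = v -> idem_equiv f e.
Proof.
move=> uv vu eu ve.
have fv : f * v = v by rewrite -vu -mulrA uv.
have ff : idempotent f by rewrite /idempotent -{2}vu mulrA fv.
exists (amulr v); split.
- apply/eqP; rewrite eqEsubv; apply/andP; split; apply/subvP => x.
    case/memv_imgP=> y _ ->; rewrite amulrE; apply/mem_lideal.
    by exists (y * v); rewrite -mulrA ve.
  case/mem_lideal=> y ->; apply/memv_imgP; exists (y * u); last first.
    by rewrite amulrE -mulrA uv.
  by apply/mem_lideal; exists (y * u); rewrite -vu !mulrA -(mulrA y) uv -mulrA eu.
- apply/eqP; rewrite -subv0; apply/subvP => x; rewrite memv_cap memv_ker amulrE memv0.
  by case/andP=> /eqP xv /(mem_lideal_idem _ ff)->; rewrite -vu mulrA xv mul0r.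
by move=> a x _; rewrite !amulrE mulrA.
Qed.

(** With [e = phi z] and [z] in [A f], linearity gives [e = z * f * phi f], and injectivity gives
    [f = phi f * e * z]. *)
Lemma idem_equiv_gen_by e f : idempotent e -> idempotent f -> idem_equiv f e ->
  e \in gen_by f /\ f \in gen_by e.
Proof.
move=> ee ff [phi [phiT phiK phiM]].
have fL : f \in lideal_of f by apply/mem_lideal_idem.
have eL : e \in lideal_of e by apply/mem_lideal_idem.
have pf : phi f = phi f * e.
  by apply/mem_lideal_idem; rewrite // -phiT memv_img.
have [z zL ez] : exists2 z, z \in lideal_of f & e = phi z by apply/memv_imgP; rewrite phiT.
have zf : z = z * f by apply/mem_lideal_idem.
have fpf : f * phi f = phi f by rewrite -phiM // ff.
split.
  by rewrite ez {1}zf phiM // -fpf mulrA mem_gen_by.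
suff -> : f = phi f * e * z by apply: mem_gen_by.
apply/eqP; rewrite -subr_eq0 -memv0 -phiK memv_cap memv_ker linearB /=.
rewrite phiM // -ez -(mulrA (phi f) e e) ee -pf subrr eqxx /=.
by apply: rpredB => //; apply/mem_lideal; exists (phi f * z); rewrite -[RHS]mulrA -zf.
Qed.

(* Both chains [x ^+ k * A] and [A * x ^+ k] are stationary. *)
Lemma strongly_pi_regular x : exists k y z,
  x ^+ k.+1 = x ^+ k.+1 * x ^+ k.+1 * y /\ x ^+ k.+1 = z * (x ^+ k.+1 * x ^+ k.+1).
Proof.
pose R k := (amull (x ^+ k) @: fullv)%VS; pose L k := (amulr (x ^+ k) @: fullv)%VS.
have RS k l : (R (k + l)%N <= R k)%VS.
  apply/subvP => _ /memv_imgP[y _ ->]; rewrite amullE exprD -mulrA -amullE.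
  by rewrite memv_img ?memvf.
have LS k l : (L (k + l)%N <= L k)%VS.
  apply/subvP => _ /memv_imgP[y _ ->]; rewrite amulrE addnC exprD mulrA -amulrE.
  by rewrite memv_img ?memvf.
pose m k := (\dim (R k.+1) + \dim (L k.+1))%N.
(* Minimising the sum of the two dimensions makes both chains stationary at once. The exponents are
   successors so that the powers of [x] stay in any corner containing [x]. *)
have [k km] : exists k, forall l, (m k <= m l)%N.
  have [N] := ubnP (m 0%N); move: 0%N => l0; elim: N l0 => // N IH l0 lN.
  have [[l ml]|nl] := classic (exists l, (m l < m l0)%N).
    by apply: (IH l); apply: leq_trans ml _.
  by exists l0 => l; rewrite leqNgt; apply/negP => ml; apply: nl; exists l.
have mk := km (k + k.+1)%N; rewrite /m -addSn in mk.
have dR := dimvS (RS k.+1 k.+1); have dL := dimvS (LS k.+1 k.+1).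
have Req : (R (k.+1 + k.+1)%N == R k.+1)%VS by rewrite eqEdim RS; lia.
have Leq : (L (k.+1 + k.+1)%N == L k.+1)%VS by rewrite eqEdim LS; lia.
have: x ^+ k.+1 \in R k.+1 by rewrite -[X in X \in _]mulr1 -amullE memv_img ?memvf.
have: x ^+ k.+1 \in L k.+1 by rewrite -[X in X \in _]mul1r -amulrE memv_img ?memvf.
rewrite -(eqP Req) -(eqP Leq) => /memv_imgP[z _ xz] /memv_imgP[y _ xy].
by exists k, y, z; rewrite -exprD; split; [rewrite xy amullE | rewrite xz amulrE].
Qed.

Definition corner_unit e x := exists y, [/\ e * y = y, y * e = y, x * y = e & y * x = e].

(** Fitting's argument: for a power [a] of [x] lying in [a^2 A] and in [A a^2], the element
    [g = a * y0 = z0 * a] is an idempotent of the corner, so it is 0 or [e]; accordingly [a] is 0 or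
    [x] is invertible. *)
Lemma primitive_local e x : primitive_idem e -> e * x = x -> x * e = x ->
  (exists k, x ^+ k = 0) \/ corner_unit e x.
Proof.
case=> e0 ee prim ex xe; have [k [y0 [z0 []]]] := strongly_pi_regular x.
set a := x ^+ k.+1 => ay za.
have ea : e * a = a by rewrite /a exprS mulrA ex.
have ae : a * e = a by rewrite /a exprSr -mulrA xe.
pose g := a * y0; have gE : g = z0 * a by rewrite /g {1}za -mulrA -ay.
have gg : idempotent g by rewrite /idempotent {1}gE /g mulrA -(mulrA z0) -za.
have eg : e * g = g by rewrite /g mulrA ea.
have ge : g * e = g by rewrite gE -mulrA ae.
have [||||g0|eg0] := prim g (e - g) gg.
- by rewrite /idempotent mulrBr !mulrBl ee eg ge gg subrr subr0.
- by rewrite mulrBr ge gg subrr.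
- by rewrite mulrBl eg gg subrr.
- by rewrite addrC subrK.
- left; exists k.+1; rewrite -/a.
  by rewrite za mulrA -gE g0 mul0r.
have {eg0}ge' : g = e by apply/esym/eqP; rewrite -subr_eq0 eg0.
right; pose w := e * (x ^+ k * y0) * e.
have xw : x * w = e by rewrite /w !mulrA xe -exprS -/a -/g ge' ee.
have ew : e * w = w by rewrite /w !mulrA ee.
have we : w * e = w by rewrite /w -mulrA ee.
have zx : z0 * x ^+ k * x = e by rewrite -mulrA -exprSr -/a -gE.
exists w; split=> //.
have -> : w = z0 * x ^+ k * e by rewrite -{1}xw mulrA zx.
by rewrite -mulrA ex.
Qed.

Lemma corner_unit_sub_nilp e p k : idempotent e -> e * p = p -> p * e = p ->
  p ^+ k = 0 -> corner_unit e (e - p).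
Proof.
move=> ee ep pe pk; pose q := \sum_(i < k) p ^+ i.
have pq : (1 - p) * q = 1 by rewrite -opprB mulNr -subrX1 pk sub0r opprK.
have qp : q * (1 - p) = 1.
  rewrite -[RHS]pq; suff : GRing.comm q (1 - p) by [].
  apply: commrB; first exact: commr1.
  by apply/commr_sym/commr_sum => i _; apply: commrX.
have ep1 : e * (1 - p) = e - p by rewrite mulrBr mulr1 ep.
have pe1 : (1 - p) * e = e - p by rewrite mulrBl mul1r pe.
exists (e * q * e); split.
- by rewrite !mulrA ee.
- by rewrite -mulrA ee.
- have -> : (e - p) * (e * q * e) = e * ((1 - p) * q) * e.
    by rewrite !mulrA mulrBl ee pe -ep1.
  by rewrite pq mulr1 ee.
have -> : e * q * e * (e - p) = e * (q * (1 - p)) * e.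
  by rewrite -(mulrA (e * q) e (e - p)) mulrBr ee ep -pe1 !mulrA.
by rewrite qp mulr1 ee.
Qed.

(** With [v] the inverse of [w], [v * x] is nilpotent or invertible in the corner. If nilpotent,
    [w - x = w * (e - v * x)] is still a unit and the induction goes on with the remaining
    summands. *)
Lemma local_sum e (s : seq A) w : primitive_idem e -> {in s, forall x, e * x = x /\ x * e = x} ->
  corner_unit e w -> w = \sum_(x <- s) x -> exists2 x, x \in s & exists y, e * y = y /\ x * y = e.
Proof.
move=> prim; elim: s w => [|x s IH] w sE wU.
  rewrite big_nil => w0; case: wU => y [_ _]; rewrite w0 mul0r => e0.
  by case: prim; rewrite -e0 eqxx.
have [ee xs] : idempotent e /\ (e * x = x /\ x * e = x).
  by split; [case: prim | apply: sE; rewrite mem_head].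
have [ex xe] := xs; case: wU => v [ev ve wv vw]; rewrite big_cons => wE.
have [||[m pm]|[q [eq qe pq qp]]] := @primitive_local e (v * x) prim.
- by rewrite mulrA ev.
- by rewrite -mulrA xe.
- have [ep pe] : e * (v * x) = v * x /\ v * x * e = v * x by rewrite mulrA ev -mulrA xe.
  have [u [eu ue pu up]] := corner_unit_sub_nilp ee ep pe pm.
  have se : \sum_(y <- s) y = w - x by rewrite wE addrC addKr.
  have ss y : y \in s -> e * y = y /\ y * e = y by move=> ys; apply: sE; rewrite inE ys orbT.
  have es : e * (w - x) = w - x.
    by rewrite -se mulr_sumr; apply: eq_big_seq => y /ss[].
  have vs : v * (w - x) = e - v * x by rewrite mulrBr vw.
  have [|y ys yU] := IH (w - x) ss _ (esym se).
    exists (u * v); split.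
    + by rewrite mulrA eu.
    + by rewrite -mulrA ve.
    + have -> : w - x = w * (e - v * x) by rewrite -vs mulrA wv es.
      by rewrite mulrA -(mulrA w) pu -mulrA ev wv.
    by rewrite -mulrA vs up.
  by exists y; rewrite // inE ys orbT.
exists x; rewrite ?mem_head //; exists (q * v); rewrite mulrA eq; split=> //.
have -> : x = w * (v * x) by rewrite mulrA wv ex.
by rewrite !mulrA -(mulrA w) -(mulrA w) pq -mulrA ev wv.
Qed.

End Idempotents.

(** * The function [F_A] and the ideals generated by the [e_lam] *)

Section Indexing.
Variables (K : fieldType) (A : falgType K) (n : nat) (estar : 'I_n.+1 -> A).
Hypothesis eG : idem_grading estar.
Implicit Types (e f g : A).

(** [e] is the sum of the [e * estar i * e], so one of these has a right inverse [y]. This factors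
    [e] as [u * v] through [estar i], and [v * u] is the wanted idempotent. *)
Lemma exists_Fle e : primitive_idem e -> exists i, Fle estar e i.
Proof.
move=> prim; have ee : idempotent e by case: prim.
pose s := [seq e * estar i * e | i <- index_enum 'I_n.+1].
have [||| _ /mapP[i _ ->] [y [ey yU]]] := @local_sum _ _ e s e prim.
- by move=> _ /mapP[i _ ->]; rewrite !mulrA ee -(mulrA (e * estar i) e e) ee.
- by exists e; split.
- by rewrite big_map -mulr_suml -mulr_sumr (estar_sum eG) mulr1 ee.
have ii := estar_idem eG i.
exists i, (estar i * (y * e) * estar i).
pose u := e * estar i; pose v := estar i * (y * e).
have uv : u * v = e.
  by rewrite /u /v !mulrA -(mulrA e) ii -ey !mulrA yU ee.
have vu : v * u = estar i * (y * e) * estar i by rewrite /u /v !mulrA -(mulrA _ e e) ee.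
have eu : e * u = u by rewrite mulrA ee.
have ve : v * e = v by rewrite /v -!mulrA ee.
split; first exact: mem_mul_corner.
  by rewrite -vu /idempotent mulrA -(mulrA v u v) uv ve.
exact: idem_equiv_of_factor uv vu eu ve.
Qed.

Lemma exists_FA e : primitive_idem e -> exists i, FA_is estar e i.
Proof.
case/exists_Fle=> i; have [m] := ubnP (i : nat); elim: m i => // m IH i im iF.
have [[j [ji jF]]|nj] := classic (exists j : 'I_n.+1, (j < i)%N /\ Fle estar e j).
  by apply: (IH j) => //; apply: leq_trans ji _.
by exists i; split=> // j ji jF; apply: nj; exists j.
Qed.

Lemma FA_is_le e (i j : 'I_n.+1) : FA_is estar e i -> Fle estar e j -> (i <= j)%N.
Proof. by case=> _ min jF; rewrite leqNgt; apply/negP => /min; apply. Qed.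

Variables (Lam : finType) (eL : Lam -> A).
Hypothesis simp : simple_index eL.

Lemma idem_lideal_lt f g g' : idempotent g -> g * g' = 0 -> g' * g = 0 ->
  f = g + g' -> g' != 0 -> (\dim (lideal_of g) < \dim (lideal_of f))%N.
Proof.
move=> gg gg' g'g fE g'0.
have gf : g = g * f by rewrite fE mulrDr gg gg' addr0.
have sub : (lideal_of g <= lideal_of f)%VS.
  by apply/subvP => _ /mem_lideal[y ->]; apply/mem_lideal; exists (y * g); rewrite -mulrA -gf.
rewrite ltnNge; apply/negP => dim; have eq : lideal_of g == lideal_of f by rewrite eqEdim sub.
have : f \in lideal_of g by rewrite (eqP eq); apply/mem_lideal; exists 1; rewrite mul1r.
move/(mem_lideal_idem _ gg); rewrite {2}fE mulrDl gg g'g addr0 fE => /eqP.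
by rewrite eq_sym addrC -subr_eq subrr eq_sym (negPf g'0).
Qed.

(** An [e_lam] with [F_A(lam) = j < r] lies in the ideal of [estar j]. Conversely [estar j] is a sum
    of primitive idempotents of its corner, each equivalent to some [e_lam] with [F_A(lam) <= j]. *)
Lemma gen_ideal_J (r : nat) (I : {vspace A}) :
  gen_ideal (Jgens estar eL r) I -> I = J estar r.
Proof.
case: simp => primL _ coverL [idI eI minI]; apply/eqP; rewrite eqEsubv; apply/andP; split.
  apply: minI (J_ideal _ _) _ => _ [l [-> [j [jr [[f [fj ff fE]] _]]]]].
  have [eLf _] := idem_equiv_gen_by (primitive_idem_idem (primL l)) ff fE.
  apply: (subvP _ _ eLf); apply: gen_by_sub => x y.
  have [ef _] := mem_cornerP _ (estar_idem eG j) fj.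
  by rewrite -ef -!mulrA mulrA mem_J.
apply: J_sub => j x y jr; apply: ideal_mulr => //; apply: ideal_mull => //.
(* Induction on the dimension of [A f]: either [f] splits into two nonzero orthogonal idempotents,
   whose left ideals are smaller, or it is primitive. *)
have in_corner f : f \in corner (estar j) -> idempotent f -> f \in I.
  have [m] := ubnP (\dim (lideal_of f)); elim: m f => // m IH f; rewrite ltnS => fm fj ff.
  have [->|f0] := eqVneq f 0; first exact: mem0v.
  have [[g [g' [gg [g'g' [gg' [g'g [fE [g0 g'0]]]]]]]]|nsplit] := classic (exists g g',
    idempotent g /\ idempotent g' /\ g * g' = 0 /\ g' * g = 0 /\ f = g + g' /\ g != 0 /\ g' != 0).
    have [ejf fej] := mem_cornerP _ (estar_idem eG j) fj.
    have fg : f * g = g by rewrite fE mulrDl gg g'g addr0.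
    have gf : g * f = g by rewrite fE mulrDr gg gg' addr0.
    have fg' : f * g' = g' by rewrite fE mulrDl g'g' gg' add0r.
    have g'f : g' * f = g' by rewrite fE mulrDr g'g' g'g add0r.
    rewrite fE; apply: rpredD; apply: IH => //.
    - by apply: leq_trans fm; apply: idem_lideal_lt fE g'0.
    - apply/(mem_cornerP _ (estar_idem eG j)); split.
        by rewrite -fg mulrA ejf.
      by rewrite -gf -mulrA fej.
    - by rewrite addrC in fE; apply: leq_trans fm; apply: idem_lideal_lt fE g0.
    apply/(mem_cornerP _ (estar_idem eG j)); split.
      by rewrite -fg' mulrA ejf.
    by rewrite -g'f -mulrA fej.
  have primf : primitive_idem f.
    split=> // g g' gg g'g' gg' g'g fE.
    have [->|g0] := eqVneq g 0; first by left.
    have [->|g'0] := eqVneq g' 0; first by right.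
    by case: nsplit; exists g, g'.
  have [l fl] := coverL f primf.
  have [i iF] := exists_FA (primL l).
  have ij : (i <= j)%N by apply: FA_is_le iF _; exists f.
  have eLI : eL l \in I by apply: eI; exists l; split=> //; exists i; split=> //; lia.
  have [_ fI] := idem_equiv_gen_by (primitive_idem_idem (primL l)) ff fl.
  apply: (subvP _ _ fI); apply: gen_by_sub => u v.
  by apply: ideal_mulr => //; apply: ideal_mull.
apply: in_corner; last exact: (estar_idem eG).
by apply/(mem_cornerP _ (estar_idem eG j)); rewrite !(estar_idem eG).
Qed.

End Indexing.

(** * Base stratification *)

Section Main.
Variables (K : fieldType) (A : falgType K) (n : nat) (e : 'I_n.+1 -> A).
Variable B : {aspace A}.
Hypotheses (eG : idem_grading e) (hB : pre_borelic e B).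

Notation H := ((B : {vspace A}) :&: Agr e 0)%VS.
Notation J := (J e).

Lemma dual_basis_mod_J (r : nat) : (r <= n.+1)%N ->
  exists k (a : 'I_k -> A) (alpha : 'I_k -> 'End(A)), dual_basis_mod B (J r) a alpha.
Proof.
elim: r => [_|r IH rn].
  have [_ _ _ projA_B _] := hB.
  have [k [a [alpha [_ alB alM alS]]]] := right_dual_basis (one_in_B hB) projA_B.
  exists k, a, alpha; split=> [t x|t x b|t x|x].
  - by rewrite alB ?memvf.
  - by move=> bB; rewrite alM ?memvf.
  - by rewrite /J big1 // memv0 => /eqP->; rewrite linear0.
  - by rewrite -alS ?memvf // subrr mem0v.
have [k [a [alpha dual]]] := IH (ltnW rn).
exists k, a, (fun t => alpha t \o residue e (Ordinal rn) a alpha n.+1)%VF.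
exact: (@dual_basis_modS _ _ _ _ _ eG hB (Ordinal rn)).
Qed.

Variables (r : 'I_n.+1) (C : falgType K) (f : 'AHom(A, C)).
Hypotheses (fT : limg f = fullv) (fK : lker f = J r).

Let f_eq0 x : (f x == 0) = (x \in J r). Proof. by rewrite -fK memv_ker. Qed.

Let f_eq x y : x - y \in J r -> f x = f y.
Proof. by rewrite -f_eq0 linearB subr_eq0 => /eqP. Qed.

(** Modulo [J r], [e_projB_J] moves an element of the corner into [e r * B], and multiplying by
    [e r] on the right leaves only the degree 0 part by [B_e_J]. *)
Lemma corner_img : corner (f (e r)) = ((f \o amull (e r))%VF @: H)%VS.
Proof.
rewrite limg_comp /corner -limg_line -fT -!aimgM.
apply/eqP; rewrite eqEsubv; apply/andP; split.
  apply/subvP => _ /memv_imgP[y yc ->].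
  have [ey ye] := mem_cornerP _ (estar_idem eG r) yc.
  pose b := projB e B y; have bB : b \in (B : {vspace A}) := projB_in e B y.
  have -> : f y = f (amull (e r) (part e 0 b)).
    rewrite amullE -ye; apply: f_eq.
    have -> : y * e r - e r * part e 0 b =
      (e r * y - e r * b) * e r + e r * (b * e r - e r * part e 0 b).
      by rewrite mulrBl mulrBr -ey !mulrA (estar_idem eG) addrA subrK.
    apply: rpredD; first by apply: ideal_mulr (J_ideal _ _) (e_projB_J eG hB r y).
    by apply: ideal_mull (J_ideal _ _) (B_e_J eG hB r bB).
  by rewrite !memv_img // (part0_H eG hB).
apply: limgS; apply/subvP => _ /memv_imgP[x xH ->]; rewrite amullE.
have -> : e r * x = e r * x * e r by rewrite -mulrA -(H_comm eG r xH) mulrA (estar_idem eG).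
exact: mem_mul_corner.
Qed.

(** On [H] the map [x |-> f (e r * x)] is multiplicative since [e r] commutes with [H], and by
    [e_mem_J] its kernel is that of multiplication by the central idempotent [h r]. *)
Lemma corner_std_based : std_based H 1 -> std_based (corner (f (e r))) (f (e r)).
Proof.
move=> stdH; rewrite corner_img.
have -> : f (e r) = (f \o amull (e r))%VF 1 by rewrite comp_lfunE amullE mulr1.
apply: (std_based_img (h := h e B r)) stdH.
- exact: one_in_H.
- exact: H_mul.
- exact: h_H.
- exact: h_idem.
- by move=> x xH; apply: h_comm.
- move=> x y xH yH; rewrite !comp_lfunE !amullE -rmorphM; congr (f _).
  by rewrite [RHS]mulrA -(mulrA (e r) x) -(H_comm eG r xH) !mulrA (estar_idem eG).
by move=> x xH; rewrite comp_lfunE amullE f_eq0 (e_mem_J eG hB) ?(H_sub_B xH).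
Qed.

Lemma base_stratifying_img : std_based H 1 -> base_stratifying (f @: J r.+1)%VS.
Proof.
move=> stdH; have [k [a [alpha dual]]] := dual_basis_mod_J (ltnW (ltn_ord r)).
have [_ _ _ _ projH] := hB.
have [kl [d [beta [_ beta_in beta_mull beta_sum]]]] := left_dual_basis (one_in_H eG hB) projH.
have idJ := J_ideal e r.+1.
exists (f (e r)); split.
- by rewrite /idempotent -rmorphM (estar_idem eG).
(* [J r.+1] is [J r] plus the ideal of [e r], and the first summand is the kernel of [f]. *)
- rewrite JS limgD (_ : f @: J r = 0)%VS; last first.
    apply/eqP; rewrite -subv0 -fK; apply/subvP => _ /memv_imgP[x xK ->].
    by move: xK; rewrite memv_ker => /eqP->; apply: mem0v.
  by rewrite add0v !aimgM limg_line fT.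
- apply: (@projective_left_img _ _ _ f (J r) _ fT fK kl (fun u => e r * d u)
            (lcoord e B r a alpha beta) idJ) => [t|t x|x|t x c].
  + by rewrite -[e r]mul1r mem_JS.
  + exact: (lcoord_J dual).
  + exact: (lcoord_sum eG hB dual beta_in beta_mull beta_sum).
  + exact: (lcoord_mull eG hB dual beta_mull).
- apply: (@projective_right_img _ _ _ f (J r) _ fT fK k (fun t => a t * e r)
            (rcoord e r a alpha) idJ) => [t|t x|x|t x c].
  + by rewrite -[a t * e r]mulr1 mem_JS.
  + exact: (rcoord_J dual).
  + exact: (rcoord_sum eG hB dual).
  + exact: (rcoord_mulr eG hB dual).
exact: corner_std_based.
Qed.

End Main.

Theorem theorem5p11 (K : fieldType) (A : falgType K) (n : nat)
  (estar : 'I_n.+1 -> A) (B : {aspace A}) (Lam : finType) (eL : Lam -> A) :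
  idem_grading estar ->
  pre_borelic estar B ->
  std_based (B :&: Agr estar 0)%VS 1 ->
  simple_index eL ->
  (* Q : Lam = disjoint union of the Lam_i := {lam | F_A(lam) = i} *)
  (forall l, exists i : 'I_n.+1, FA_is estar (eL l) i) /\
  (* (A, Q) is base stratified: for 1 <= i <= n+1, J_i/J_{i-1} is a base
     stratifying ideal of A/J_{i-1}; A/J_{i-1} is realised by any surjective
     algebra homomorphism f : A -> C with kernel J_{i-1}. *)
  (forall i : nat, (1 <= i <= n.+1)%N ->
   forall Jprev Ji : {vspace A},
     gen_ideal (Jgens estar eL i.-1) Jprev ->
     gen_ideal (Jgens estar eL i) Ji ->
     forall (C : falgType K) (f : 'AHom(A, C)),
       limg f = fullv -> lker f = Jprev ->
       base_stratifying (f @: Ji)%VS).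
Proof.
move=> eG hB stdH simp; split=> [l|[//|r] /= rn Jprev Ji].
  by apply: (exists_FA eG); case: simp.
move=> /(gen_ideal_J eG simp)-> /(gen_ideal_J eG simp)-> C f fT fK.
exact: (@base_stratifying_img _ _ _ _ _ eG hB (Ordinal rn)).
Qed.
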